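(* Let $G\sim\mathbb{G}(n,p_n)$ be an Erdős–Rényi random graph on vertex set $V_n$, conditioned on the edge $(a,b)$ being present, where $a,b\in V_n$ are fixed, and let $\kappa_n(a,b)$ be the Ricci curvature of the edge $(a,b)$ in $G$. Then: (a) If $np_n\to0$, then with probability $1-o(1)$ the edge $(a,b)$ is isolated, and consequently $\kappa_n(a,b)=0$. (b) If $np_n\to\lambda$ with $0<\lambda<\infty$, then $\kappa_n(a,b)$ converges in distribution to $-2\left(1-\frac{1}{1+X_1}-\frac{1}{1+X_2}\right)_+$, where $X_1,X_2$ are independent Poisson($\lambda$) random variables. (c) If $np_n\to\infty$ and $n^2p_n^3\to0$, then $\kappa_n(a,b)\to-2$ in probability. (d) If $n^2p_n^3\to\infty$ and $np_n^2\to0$, then $\kappa_n(a,b)\to-1$ in probability. (e) If $np_n^2\to\infty$ and $p_n\to0$, then $\kappa_n(a,b)\to0$ in probability. (f) If $p_n\to p$ with $0<p<1$, then $\kappa_n(a,b)\to p$ in probability.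
   Context: $\mathbb{G}(n,p)$ is the random graph on $n$ vertices in which each pair of vertices is an edge independently with probability $p$. For a graph $G$, $d_G$ is the shortest-path metric, $N_G(v)$ the neighbour set and $d_v$ the degree of $v$; $m_v$ is the uniform probability measure on $N_G(v)$, and for an edge $(x,y)$ the Ricci curvature is $\kappa(x,y)=1-W_1(m_x,m_y)$, where $W_1$ is the Wasserstein-1 (transportation) distance with respect to $d_G$. $(t)_+=\max(t,0)$. *)

(* Defs.v *)
From HB Require Import structures.
From mathcomp Require Import all_boot all_order all_algebra.
From mathcomp Require Import all_classical all_reals all_analysis.
From mathcomp Require Import poisson_distribution.
Set Implicit Arguments. Unset Strict Implicit. Unset Printing Implicit Defensive.
Import Order.TTheory GRing.Theory Num.Theory numFieldTopology.Exports.
Local Open Scope classical_set_scope.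
Local Open Scope ring_scope.

Section Graphs.
Variable N : nat.

(** Unordered pairs {x,y} of distinct vertices of 'I_N, represented as x < y. *)
Definition upair := {x : 'I_N * 'I_N | (x.1 < x.2)%N}.

Definition graph := {ffun upair -> bool}.

Definition adj (G : graph) (x y : 'I_N) : bool :=
  [exists e : upair, ((val e == (x, y)) || (val e == (y, x))) && G e].

Fixpoint reach (G : graph) (k : nat) (x y : 'I_N) : bool :=
  match k with
  | 0 => x == y
  | k'.+1 => [exists z, adj G x z && reach G k' z y]
  end.

(** shortest-path distance d_G; a shortest path has fewer than N edges, so
    the bound N is only reached for pairs in different components
    (conventional value for an infinite distance; never used for the
    distances relevant to an edge). *)
Definition dist (G : graph) (x y : 'I_N) : nat :=
  \big[minn/N]_(k < N | reach G k x y) k.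

Definition nbhd (G : graph) (v : 'I_N) : {set 'I_N} := [set u | adj G v u].
Definition deg (G : graph) (v : 'I_N) : nat := #|nbhd G v|.

Variable R : realType.

Definition unif_nbhd (G : graph) (v : 'I_N) (u : 'I_N) : R :=
  (u \in nbhd G v)%:R / (deg G v)%:R.

Definition coupling (mu nu : 'I_N -> R) (pi : 'I_N -> 'I_N -> R) : Prop :=
  [/\ forall x y, 0 <= pi x y,
      forall x, \sum_(y : 'I_N) pi x y = mu x &
      forall y, \sum_(x : 'I_N) pi x y = nu y].

Definition W1 (d : 'I_N -> 'I_N -> nat) (mu nu : 'I_N -> R) : R :=
  inf [set c | exists2 pi, coupling mu nu pi &
               c = \sum_(x : 'I_N) \sum_(y : 'I_N) pi x y * (d x y)%:R].

Definition ricci (G : graph) (x y : 'I_N) : R :=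
  1 - W1 (dist G) (unif_nbhd G x) (unif_nbhd G y).

Definition gnp_weight (p : R) (G : graph) : R :=
  \prod_(e : upair) (if G e then p else 1 - p).

Definition cond_prob (p : R) (a b : 'I_N) (A : pred graph) : R :=
  (\sum_(G : graph | adj G a b && A G) gnp_weight p G) /
  (\sum_(G : graph | adj G a b) gnp_weight p G).

Definition isolated_edge (G : graph) (a b : 'I_N) : bool :=
  (nbhd G a == [set b]%SET) && (nbhd G b == [set a]%SET).

End Graphs.

Arguments unif_nbhd {N R}.
Arguments coupling {N R}.
Arguments W1 {N R}.
Arguments ricci {N R}.

(** Random graphs indexed by n live on the vertex set 'I_n.+2, i.e. with
    n.+2 vertices; p n is the edge probability for the graph with n.+2
    vertices; a n, b n are the fixed vertices. *)

Definition conv_in_prob (R : realType) (p : nat -> R)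
    (a b : forall n, 'I_n.+2) (X : forall n, graph n.+2 -> R) (c : R) : Prop :=
  forall eps : R, 0 < eps ->
    cond_prob (p n) (a n) (b n) (fun G => eps < `|X n G - c|)
      @[n --> \oo] --> 0.

Definition Ylimit (R : realType) (k1 k2 : nat) : R :=
  - 2 * Num.max 0 (1 - (1 + k1%:R)^-1 - (1 + k2%:R)^-1).

Definition Ylimit_cdf (R : realType) (lambda : R) (t : R) : R :=
  fine (\esum_(k in [set k : nat * nat | Ylimit R k.1 k.2 <= t])
          (poisson_pmf lambda k.1 * poisson_pmf lambda k.2)%:E).

Definition conv_in_dist (R : realType) (p : nat -> R)
    (a b : forall n, 'I_n.+2) (X : forall n, graph n.+2 -> R)
    (F : R -> R) : Prop :=
  forall t : R, {for t, continuous F} ->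
    cond_prob (p n) (a n) (b n) (fun G => X n G <= t) @[n --> \oo] --> F t.

(* Main.v *)
Require Import Defs.
From HB Require Import structures.
From mathcomp Require Import all_boot all_order all_algebra finmap.
From mathcomp Require Import all_classical all_reals all_analysis.
From mathcomp Require Import poisson_distribution.
From mathcomp Require Import ring lra zify.
Set Implicit Arguments. Unset Strict Implicit. Unset Printing Implicit Defensive.
Import Order.TTheory GRing.Theory Num.Theory numFieldTopology.Exports.
Local Open Scope classical_set_scope.
Local Open Scope ring_scope.

(** Let [A] and [B] be the neighbourhoods of [a] and [b] without the endpoints
    of the edge. All transport takes place between [A] and [b] on one side, and
    [B] and [a] on the other, at distances at most 3, so [W1] is governed by the
    paths of length 2, 3 and 4 from [a] to [b].

    Lower bounds on [W1] come from potentials in the dual problem that vanish on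
    the few vertices of [A] starting a short path to [B]; first moments show that
    such vertices are rare. Upper bounds come from almost couplings: in regime
    (d) the mass of [x] in [A] is spread over the ends of the paths x-z-y-b, and
    in regimes (e) and (f) the common neighbours of [a] and [b] stay where they
    are while the mass of the other [x] is spread over the edges x-y to [B].
    Second moments show that the marginals of these plans are close in total
    variation to the uniform measures, and a plan with approximate marginals can
    be repaired at a cost proportional to the error. Regimes (e) and (f) are
    treated together as [n p^2 -> oo] and [p -> q < 1].

    In regime (b) there is no short path with high probability, the curvature is
    then an explicit function of the two degrees, and these are independent
    binomial variables converging to Poisson ones. *)

(** A vertex x of A has on average about n p^2 paths x-y-b and n^2 p^3 paths x-z-y-b. These two
    quantities decide whether a typical x lies at distance 3, 2 or 1 from B, and the limits -2, -1,
    0 are 1 minus that distance; in (f) a proportion p of A lies in B already and the cost drops to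
    1 - p. The obstacle is to find a nearly optimal plan. A matching of A into B would call for a
    Hall-type argument; instead every path out of x carries the same deterministic mass c, so that
    the row of x is c times a number of paths. The error of the marginals is a sum over x of terms
    of size 1/(np), each present with probability p. It vanishes in mean as soon as the relative
    variance of the number of paths, given the edge a-x, tends to 0 at a rate common to all x; no
    union bound over x is taken. Reversing the paths exchanges a and b, so the columns need no
    moment computation of their own. *)

(** * Product measure on graphs: the weight of a prescribed pattern of edges *)

Section ProductMeasure.
Variables (N : nat) (R : realType).
Implicit Types (G : graph N) (x y z : 'I_N) (p : R).

Lemma adj_sym G x y : adj G x y = adj G y x.
Proof. by rewrite /adj; apply: eq_existsb => e; rewrite orbC. Qed.

Lemma adjxx G x : adj G x x = false.
Proof.
apply/existsP => -[[[u v] uv]] /= /andP[+ _]; rewrite orbb => /eqP[ux vx].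
by move: uv; rewrite ux vx ltnn.
Qed.

Lemma adj_neq G x y : adj G x y -> x != y.
Proof. by apply: contraTneq => ->; rewrite adjxx. Qed.

(** Indices of the potential edges: the unordered pair of [u.1] and [u.2],
    meaningful only off the diagonal. *)
Definition upair_of (u : 'I_N * 'I_N) : option (upair N) :=
  insub (if (u.1 < u.2)%N then u else (u.2, u.1)).

Definition same_pair (u v : 'I_N * 'I_N) : bool :=
  (u.1 == v.1) && (u.2 == v.2) || (u.1 == v.2) && (u.2 == v.1).

Lemma upair_ofP (u : 'I_N * 'I_N) : u.1 != u.2 ->
  {e : upair N | upair_of u = Some e & (val e == u) || (val e == (u.2, u.1))}.
Proof.
move=> n12; rewrite /upair_of; case: ifPn => h.
  by exists (Sub u h) => /=; rewrite ?insubT// eqxx.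
have h' : ((u.2, u.1).1 < (u.2, u.1).2)%N.
  by rewrite /= ltn_neqAle leqNgt h andbT eq_sym.
by exists (Sub (u.2, u.1) h'); rewrite ?insubT//= eqxx orbT.
Qed.

Lemma upair_of_inj (u v : 'I_N * 'I_N) : u.1 != u.2 -> v.1 != v.2 ->
  upair_of u = upair_of v -> same_pair u v.
Proof.
move=> /upair_ofP[e -> he] /upair_ofP[f -> hf] [ef]; rewrite -{}ef in hf.
case: u v he hf => [u1 u2] [v1 v2] /= /orP[]/eqP-> /orP[]/eqP[-> ->];
by rewrite /same_pair /= !eqxx ?orbT.
Qed.

Lemma adjE G (u : 'I_N * 'I_N) (e : upair N) :
  upair_of u = Some e -> adj G u.1 u.2 = G e.
Proof.
move=> ue.
have n12 : u.1 != u.2.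
  by apply/eqP => h; move: ue; rewrite /upair_of h ltnn insubF //= ltnn.
have [e' ] := upair_ofP n12; rewrite ue => -[<-] {e'} he.
have lte : ((val e).1 < (val e).2)%N by exact: (valP e).
apply/existsP/idP => [[f /andP[hf Gf]]|Ge]; last first.
  by exists e; rewrite Ge andbT -surjective_pairing.
suff -> : e = f by [].
have ltf : ((val f).1 < (val f).2)%N by exact: (valP f).
apply: val_inj; move: he hf lte ltf; rewrite -surjective_pairing.
by move=> /orP[]/eqP-> /orP[]/eqP-> //= h1 h2; have := ltn_trans h1 h2; rewrite ltnn.
Qed.

Definition lit_weight p (c : bool) : R := if c then p else 1 - p.

Lemma sum_gnp_prod p (f : upair N -> bool -> R) :
  \sum_(G : graph N) gnp_weight p G * \prod_e f e (G e) =
  \prod_e \sum_(c : bool) lit_weight p c * f e c.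
Proof.
rewrite bigA_distr_bigA /=; apply: eq_bigr => G _.
by rewrite /gnp_weight -big_split.
Qed.

(** The indicator of the pattern is a product over edges of the tests bearing on that edge, so
    [sum_gnp_prod] applies; an edge without a test contributes p + (1 - p) = 1. *)
Lemma sum_lits_upair p (s : seq (upair N * bool)) : uniq (map fst s) ->
  \sum_(G : graph N | all (fun l => G l.1 == l.2) s) gnp_weight p G =
  \prod_(l <- s) lit_weight p l.2.
Proof.
move=> us.
pose f (e : upair N) (c : bool) : R := \prod_(l <- s | l.1 == e) (c == l.2)%:R.
transitivity (\sum_(G : graph N) gnp_weight p G * \prod_e f e (G e)).
  rewrite big_mkcond /=; apply: eq_bigr => G _.
  have -> : \prod_e f e (G e) = \prod_(l <- s) (G l.1 == l.2)%:R.
    under eq_bigr => e _ do rewrite /f big_mkcond.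
    rewrite exchange_big /=; apply: eq_bigr => l _.
    by rewrite -big_mkcond (big_pred1 l.1).
  have -> : \prod_(l <- s) (G l.1 == l.2)%:R = (all (fun l => G l.1 == l.2) s)%:R :> R.
    elim: {us f} s => [|l s IH]; rewrite ?big_nil// big_cons IH /=.
    by case: (_ == _); rewrite ?mul1r ?mul0r.
  by case: all; rewrite ?mulr1 ?mulr0.
rewrite sum_gnp_prod {}/f.
elim: s us => [|[e c] s IH] /=.
  move=> _; rewrite big_nil big1// => e _.
  by rewrite big_bool /= !big_nil !mulr1 addrC subrK.
case/andP=> es us; rewrite big_cons -IH //=.
(* The factor of the new literal becomes a product over all edges, equal to 1 away from [e], so that
   the two sides can be compared edge by edge. *)
rewrite [RHS](_ : _ = (\prod_(e' : upair N) (if e' == e then lit_weight p c else 1)) *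
  \prod_(e' : upair N) \sum_(c0 : bool) lit_weight p c0 *
     \prod_(l <- s | l.1 == e') (c0 == l.2)%:R); last first.
  by congr (_ * _); rewrite -big_mkcond big_pred1_eq.
rewrite -big_split; apply: eq_bigr => e' _ /=.
rewrite [in LHS]big_bool [in RHS]big_bool /=; rewrite !big_cons /= (eq_sym e').
case: ifPn => [/eqP <-|_]; last by rewrite mul1r.
have s0 c0 : \prod_(l <- s | l.1 == e) (c0 == l.2)%:R = 1 :> R.
  rewrite big_seq_cond big1// => l /andP[ls /eqP le].
  by case/negP: es; apply/mapP; exists l.
by rewrite !s0 /=; case: c => /=; rewrite !mulr1 !mulr0 ?addr0 ?add0r /lit_weight addrC subrK mulr1.
Qed.

Definition lit := ('I_N * 'I_N * bool)%type.

Definition holds G (l : lit) : bool := adj G l.1.1 l.1.2 == l.2.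

(** The literals bear on distinct potential edges. As a boolean, this is evaluated on explicit lists
    from inequalities between vertices. *)
Definition indep_lits (s : seq lit) : bool :=
  all (fun l => l.1.1 != l.1.2) s && pairwise (fun l l' => ~~ same_pair l.1 l'.1) s.

Lemma sum_lits p (s : seq lit) : indep_lits s ->
  \sum_(G : graph N | all (holds G) s) gnp_weight p G =
  \prod_(l <- s) lit_weight p l.2.
Proof.
case/andP=> nd ps.
pose t := pmap (fun l : lit => omap (fun e => (e, l.2)) (upair_of l.1)) s.
have tE : forall G, all (holds G) s = all (fun l => G l.1 == l.2) t.
  move=> G; rewrite /t; elim: {t ps} s nd => //= l s IH /andP[hl /IH ->].
  have [e he _] := upair_ofP hl; rewrite he /=; congr (_ && _).
  by rewrite /holds (adjE _ he).
have -> : \prod_(l <- s) lit_weight p l.2 = \prod_(l <- t) lit_weight p l.2.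
  rewrite /t; elim: {t ps tE} s nd => [|l s IH] /=; first by rewrite !big_nil.
  case/andP=> hl /IH sE; have [e -> _] := upair_ofP hl.
  by rewrite /= !big_cons sE.
rewrite -sum_lits_upair; first by apply: eq_bigl => G; rewrite tE.
rewrite /t; elim: {t tE} s nd ps => //= l s IH /andP[hl hs] /andP[ls ps].
have [e he _] := upair_ofP hl; rewrite he /= IH// andbT.
apply/negP => /mapP[[e' c] /= + ee']; rewrite -{e'}ee'.
rewrite mem_pmap => /mapP[l' l's].
have hl' := allP hs _ l's; have := allP ls _ l's.
have [e' he' _] := upair_ofP hl'; rewrite he' /= => /negP + [ee' _].
by apply; apply: upair_of_inj => //; rewrite he he' ee'.
Qed.

Lemma gnp_weight_ge0 p G : 0 <= p <= 1 -> 0 <= gnp_weight p G.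
Proof. by case/andP=> p0 p1; apply: prodr_ge0 => e _; case: (G e) => //; lra. Qed.

End ProductMeasure.

(** * Expectation conditioned on the edge a-b *)

Section ConditionalExpectation.
Variables (N : nat) (R : realType) (p : R) (a b : 'I_N).
Hypotheses (p01 : 0 < p <= 1) (ab : a != b).
Implicit Types (G : graph N) (f g : graph N -> R) (s : seq (lit N)).

Definition cond_exp f : R :=
  (\sum_(G : graph N | adj G a b) gnp_weight p G * f G) /
  (\sum_(G : graph N | adj G a b) gnp_weight p G).

Lemma sum_adj : \sum_(G : graph N | adj G a b) gnp_weight p G = p.
Proof.
transitivity (\prod_(l <- [:: ((a, b), true)]) lit_weight p l.2); last by rewrite big_seq1.
rewrite -sum_lits; last by rewrite /indep_lits /= ab.
by apply: eq_bigl => G; rewrite /holds /= eqb_id andbT.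
Qed.

Lemma cond_expE f :
  cond_exp f = (\sum_(G : graph N | adj G a b) gnp_weight p G * f G) / p.
Proof. by rewrite /cond_exp sum_adj. Qed.

Lemma cond_probE (A : pred (graph N)) :
  cond_prob p a b A = cond_exp (fun G => (A G)%:R).
Proof.
rewrite /cond_prob /cond_exp; congr (_ / _); rewrite big_mkcondr.
by apply: eq_bigr => G _; case: (A G); rewrite ?mulr1 ?mulr0.
Qed.

Lemma ler_cond_exp f g : (forall G, adj G a b -> f G <= g G) ->
  cond_exp f <= cond_exp g.
Proof.
move=> fg; rewrite !cond_expE ler_pM2r ?invr_gt0; last by case/andP: p01.
apply: ler_sum => G hG; apply: ler_wpM2l; last exact: fg.
by apply: gnp_weight_ge0; case/andP: p01 => /ltW -> ->.
Qed.

Lemma eq_cond_exp f g : (forall G, adj G a b -> f G = g G) ->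
  cond_exp f = cond_exp g.
Proof. by move=> fg; congr (_ / _); apply: eq_bigr => G /fg ->. Qed.

Lemma cond_expD f g : cond_exp (fun G => f G + g G) = cond_exp f + cond_exp g.
Proof.
rewrite /cond_exp -mulrDl -big_split; congr (_ / _).
by apply: eq_bigr => G _; rewrite mulrDr.
Qed.

Lemma cond_expZ c f : cond_exp (fun G => c * f G) = c * cond_exp f.
Proof.
rewrite /cond_exp mulrA big_distrr; congr (_ / _).
by apply: eq_bigr => G _; rewrite mulrCA.
Qed.

Lemma cond_exp_sum (I : Type) (r : seq I) (P : pred I) (F : I -> graph N -> R) :
  cond_exp (fun G => \sum_(i <- r | P i) F i G) = \sum_(i <- r | P i) cond_exp (F i).
Proof.
rewrite /cond_exp -big_distrl exchange_big; congr (_ / _).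
by apply: eq_bigr => G _; rewrite -big_distrr.
Qed.

Lemma cond_exp_cst c : cond_exp (fun=> c) = c.
Proof.
rewrite cond_expE -big_distrl /= sum_adj mulrC mulKf //.
by case/andP: p01 => /lt0r_neq0.
Qed.

(** Conditioning adds the literal [(a, b, true)] to the pattern and divides by its factor p. *)
Lemma cond_exp_lits s : indep_lits ((a, b, true) :: s) ->
  cond_exp (fun G => (all (holds G) s)%:R) = \prod_(l <- s) lit_weight p l.2.
Proof.
move=> h; rewrite -cond_probE /cond_prob sum_adj.
have := sum_lits p h; rewrite big_cons /= => hs.
have -> : \sum_(G | adj G a b && all (holds G) s) gnp_weight p G =
    p * \prod_(l <- s) lit_weight p l.2.
  by rewrite -hs; apply: eq_bigl => G; rewrite {2}/holds /= eqb_id.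
by rewrite mulrC mulKf //; case/andP: p01 => /lt0r_neq0.
Qed.

Lemma cond_exp_ge0 f : (forall G, adj G a b -> 0 <= f G) -> 0 <= cond_exp f.
Proof. by move=> f0; rewrite -[leLHS](cond_exp_cst 0); apply: ler_cond_exp. Qed.

Lemma le_cond_prob (A B : pred (graph N)) :
  (forall G, adj G a b -> A G -> B G) -> cond_prob p a b A <= cond_prob p a b B.
Proof.
move=> AB; rewrite !cond_probE; apply: ler_cond_exp => G /AB.
by rewrite ler_nat; case: (A G); case: (B G) => // /(_ isT).
Qed.

Lemma cond_prob_ge0 (A : pred (graph N)) : 0 <= cond_prob p a b A.
Proof. by rewrite cond_probE; apply: cond_exp_ge0. Qed.

Lemma cond_probU (A B : pred (graph N)) :
  cond_prob p a b (fun G => A G || B G) <= cond_prob p a b A + cond_prob p a b B.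
Proof.
rewrite !cond_probE -cond_expD; apply: ler_cond_exp => G _.
by case: (A G); case: (B G); rewrite /= -natrD ler_nat.
Qed.

Lemma cond_probC (A : pred (graph N)) :
  cond_prob p a b (fun G => ~~ A G) = 1 - cond_prob p a b A.
Proof.
apply/eqP; rewrite eq_sym subr_eq -[X in X == _](cond_exp_cst 1) !cond_probE -cond_expD.
by apply/eqP/eq_cond_exp => G _; case: (A G); rewrite ?addr0 ?add0r.
Qed.

(** Markov's inequality, with the exceptional event written as a negation to fit the form of
    [whp]. *)
Lemma cond_prob_markov f c : 0 < c -> (forall G, adj G a b -> 0 <= f G) ->
  cond_prob p a b (fun G => ~~ (f G <= c)) <= cond_exp f / c.
Proof.
move=> c0 f0; rewrite cond_probE mulrC -cond_expZ; apply: ler_cond_exp => G hG.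
case: (leP (f G) c) => h /=.
  by rewrite mulr_ge0 ?f0// invr_ge0 ltW.
by rewrite mulrC ler_pdivlMr// mul1r ltW.
Qed.

End ConditionalExpectation.

(** * Optimal transport: weak duality and repair of approximate couplings *)

Section Transport.
Variables (N : nat) (R : realType) (d : 'I_N -> 'I_N -> nat) (mu nu : 'I_N -> R).
Hypotheses (mu_ge0 : forall x, 0 <= mu x) (nu_ge0 : forall y, 0 <= nu y).
Hypotheses (mu_sum : \sum_x mu x = 1) (nu_sum : \sum_y nu y = 1).
Implicit Types pi : 'I_N -> 'I_N -> R.

Let cost pi : R := \sum_x \sum_y pi x y * (d x y)%:R.

Lemma W1_le_cost pi : coupling mu nu pi -> W1 d mu nu <= cost pi.
Proof.
move=> cpi; apply: ge_inf; last by exists pi.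
exists 0 => _ [pi' [pi'0 _ _] ->]; apply: sumr_ge0 => x _; apply: sumr_ge0 => y _.
by rewrite mulr_ge0.
Qed.

Lemma coupling_prod : coupling mu nu (fun x y => mu x * nu y).
Proof.
split=> [x y|x|y]; first exact: mulr_ge0.
  by rewrite -big_distrr /= nu_sum mulr1.
by rewrite -big_distrl /= mu_sum mul1r.
Qed.

Lemma coupling_supp pi x y : coupling mu nu pi -> 0 < pi x y -> 0 < mu x /\ 0 < nu y.
Proof.
case=> pi0 rows cols h; split; apply: lt_le_trans h _.
  by rewrite -rows (bigD1 y)//= lerDl sumr_ge0.
by rewrite -cols (bigD1 x)//= lerDl sumr_ge0.
Qed.

(** Integrate the pointwise inequality against any coupling. Since it is asked on the two supports
    only, potentials can be chosen on the neighbourhoods without being Lipschitz on the whole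
    graph. *)
Lemma W1_ge_dual (f g : 'I_N -> R) :
  (forall x y, 0 < mu x -> 0 < nu y -> f x - g y <= (d x y)%:R) ->
  \sum_x f x * mu x - \sum_y g y * nu y <= W1 d mu nu.
Proof.
move=> fg; apply: lb_le_inf.
  (* The infimum of an empty set would be a default value, so some coupling has to be exhibited. *)
  by exists (cost (fun x y => mu x * nu y)); exists (fun x y => mu x * nu y) => //;
    exact: coupling_prod.
move=> _ [pi cpi ->]; have [pi0 rows cols] := cpi.
have -> : \sum_x f x * mu x = \sum_x \sum_y f x * pi x y.
  by apply: eq_bigr => x _; rewrite -big_distrr /= rows.
have -> : \sum_y g y * nu y = \sum_x \sum_y g y * pi x y.
  by rewrite exchange_big; apply: eq_bigr => y _; rewrite -big_distrr /= cols.
rewrite -sumrB; apply: ler_sum => x _; rewrite -sumrB; apply: ler_sum => y _.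
rewrite -mulrBl mulrC; have := pi0 x y; rewrite le_eqVlt => /predU1P[<-|h].
  by rewrite !mul0r.
have [mx ny] := coupling_supp cpi h.
by rewrite ler_pM2l// fg.
Qed.

Lemma W1_le_diam (K : R) :
  (forall x y, 0 < mu x -> 0 < nu y -> (d x y)%:R <= K) -> W1 d mu nu <= K.
Proof.
move=> dK; apply: le_trans (W1_le_cost coupling_prod) _.
have -> : K = \sum_x \sum_y mu x * nu y * K.
  rewrite [RHS](_ : _ = (\sum_x mu x) * (\sum_y nu y) * K); first by rewrite mu_sum nu_sum !mul1r.
  rewrite big_distrl big_distrl /=; apply: eq_bigr => x _.
  by rewrite big_distrr big_distrl.
apply: ler_sum => x _; apply: ler_sum => y _.
have := mu_ge0 x; rewrite le_eqVlt => /predU1P[<-|mx]; first by rewrite !mul0r.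
have := nu_ge0 y; rewrite le_eqVlt => /predU1P[<-|ny]; first by rewrite mulr0 !mul0r.
by apply: ler_wpM2l; [rewrite mulr_ge0|exact: dK].
Qed.

(* The rows and columns of [pi0] in excess are scaled down, and the missing
   mass is transported by a product coupling. *)
Lemma W1_le_approx_coupling (K : R) pi0 : 0 <= K ->
  (forall x y, 0 < mu x -> 0 < nu y -> (d x y)%:R <= K) ->
  (forall x y, 0 <= pi0 x y) ->
  W1 d mu nu <= cost pi0 +
    K * (\sum_x `|\sum_y pi0 x y - mu x| + \sum_y `|\sum_x pi0 x y - nu y|).
Proof.
move=> K0 dK pi00.
pose r x := \sum_y pi0 x y; pose c y := \sum_x pi0 x y.
pose al x := Num.min 1 (mu x / r x); pose be y := Num.min 1 (nu y / c y).
have r0 x : 0 <= r x by exact: sumr_ge0.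
have c0 y : 0 <= c y by exact: sumr_ge0.
have al0 x : 0 <= al x by rewrite le_min ler01 divr_ge0.
have be0 y : 0 <= be y by rewrite le_min ler01 divr_ge0.
have al1 x : al x <= 1 by rewrite ge_min lexx.
have be1 y : be y <= 1 by rewrite ge_min lexx.
(* For t = 0 the quotient is the default value 0, and both claims still hold. *)
have trim (t m : R) : 0 <= t -> 0 <= m ->
    t * Num.min 1 (m / t) <= m /\ t - t * Num.min 1 (m / t) <= Num.max 0 (t - m).
  move=> t0 m0; have := t0; rewrite le_eqVlt => /predU1P[<-|tp].
    by rewrite !mul0r subr0 le_max lexx.
  have [h|h] := leP 1 (m / t).
    by rewrite mulr1 subrr le_max lexx; split => //; move: h; rewrite ler_pdivlMr// mul1r.
  by rewrite mulrC divfK ?gt_eqF//; split => //; rewrite le_max lexx orbT.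
have alr x : r x * al x <= mu x by have [] := trim (r x) (mu x) (r0 x) (mu_ge0 x).
have bec y : c y * be y <= nu y by have [] := trim (c y) (nu y) (c0 y) (nu_ge0 y).
have becD y : c y - c y * be y <= Num.max 0 (c y - nu y).
  by have [] := trim (c y) (nu y) (c0 y) (nu_ge0 y).
have alrD x : r x - r x * al x <= Num.max 0 (r x - mu x).
  by have [] := trim (r x) (mu x) (r0 x) (mu_ge0 x).
pose pi1 x y := pi0 x y * al x * be y.
have pi10 x y : 0 <= pi1 x y by rewrite !mulr_ge0.
have pi1le x y : pi1 x y <= pi0 x y.
  by rewrite /pi1 -mulrA ler_piMr// mulr_ile1.
pose m1 x := mu x - \sum_y pi1 x y; pose n1 y := nu y - \sum_x pi1 x y.
have m10 x : 0 <= m1 x.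
  rewrite subr_ge0; apply: le_trans (alr x); rewrite /r big_distrl /=.
  by apply: ler_sum => y _; rewrite /pi1 ler_piMr// mulr_ge0.
have n10 y : 0 <= n1 y.
  rewrite subr_ge0; apply: le_trans (bec y); rewrite /c big_distrl /=.
  by apply: ler_sum => x _; rewrite /pi1 mulrAC ler_piMr// mulr_ge0.
(* The mass still to be moved; it is the same for rows and columns because both measures have total
   mass 1. *)
pose D := \sum_x m1 x.
have Dn : D = \sum_y n1 y by rewrite /D /m1 /n1 !sumrB mu_sum nu_sum exchange_big.
have D0 : 0 <= D by apply: sumr_ge0.
have Dle : D <= \sum_x `|r x - mu x| + \sum_y `|c y - nu y|.
  have h1 : \sum_x \sum_y (pi0 x y - pi1 x y) <=
      \sum_x Num.max 0 (r x - mu x) + \sum_y Num.max 0 (c y - nu y).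
    apply: (@le_trans _ _ (\sum_x \sum_y ((pi0 x y - pi0 x y * al x) +
                                     (pi0 x y - pi0 x y * be y)))).
      apply: ler_sum => x _; apply: ler_sum => y _; rewrite /pi1 -mulrA.
      (* That is, 1 - al be <= (1 - al) + (1 - be): the mass removed is charged to rows and columns
         separately. *)
      have h : 0 <= pi0 x y * ((1 - al x) * (1 - be y)).
        by rewrite !mulr_ge0// subr_ge0.
      lra.
    under eq_bigr do rewrite big_split.
    rewrite big_split /=; apply: lerD.
      apply: ler_sum => x _; apply: le_trans (alrD x).
      by rewrite sumrB /r big_distrl.
    rewrite exchange_big; apply: ler_sum => y _; apply: le_trans (becD y).
    by rewrite sumrB /c big_distrl.
  have -> : D = \sum_x (mu x - r x) + \sum_x \sum_y (pi0 x y - pi1 x y).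
    rewrite -big_split; apply: eq_bigr => x _.
    by rewrite /m1 /r /= sumrB; ring.
  apply: (@le_trans _ _ (\sum_x (mu x - r x) + (\sum_x Num.max 0 (r x - mu x) + \sum_y Num.max 0 (c y - nu y)))).
    by rewrite lerD2l.
  rewrite addrA -big_split; apply: lerD; apply: ler_sum => x _ /=.
    have [h|h] := leP 0 (r x - mu x); first by rewrite (ger0_norm h); lra.
    by rewrite (ltr0_norm h); lra.
  by rewrite ge_max normr_ge0 ler_norm.
pose pi x y := pi1 x y + m1 x * n1 y / D.
have cpi : coupling mu nu pi.
  (* If D = 0 the product term of [pi] is a default value, and the trimmed plan must already have
     the right marginals. *)
  have z1 x : D = 0 -> m1 x = 0.
    by move=> /eqP; rewrite /D psumr_eq0// => /allP/(_ x); rewrite mem_index_enum => /(_ isT)/eqP.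
  have z2 y : D = 0 -> n1 y = 0.
    by rewrite Dn => /eqP; rewrite psumr_eq0// => /allP/(_ y); rewrite mem_index_enum => /(_ isT)/eqP.
  split.
  - by move=> x y; rewrite addr_ge0// divr_ge0// mulr_ge0.
  - move=> x; rewrite big_split /= -big_distrl -big_distrr /= -Dn.
    have [/eqP D_0|Dn0] := boolP (D == 0); last by rewrite mulfK// addrC subrK.
    by have := z1 x D_0; rewrite {1}/m1 D_0 mulr0 mul0r addr0 => /eqP; rewrite subr_eq0 => /eqP.
  - move=> y; rewrite big_split /=.
    have -> : \sum_x m1 x * n1 y / D = D * n1 y / D by rewrite -2!big_distrl.
    have [/eqP D_0|Dn0] := boolP (D == 0).
      by have := z2 y D_0; rewrite {1}/n1 D_0 !mul0r addr0 => /eqP; rewrite subr_eq0 => /eqP.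
    by rewrite mulrAC mulfV// mul1r addrC subrK.
apply: le_trans (W1_le_cost cpi) _.
apply: (@le_trans _ _ (cost pi0 + K * D)); last by rewrite lerD2l ler_wpM2l.
have -> : K * D = \sum_x \sum_y m1 x * n1 y / D * K.
  rewrite [RHS](_ : _ = D * D / D * K).
    have [/eqP ->|Dn0] := boolP (D == 0); first by rewrite !(mulr0, mul0r).
    by rewrite mulfK// mulrC.
  have -> : D * D / D * K = D * (D / D * K) by rewrite !mulrA.
  rewrite {1}/D big_distrl /=; apply: eq_bigr => x _.
  by rewrite -2!big_distrl -big_distrr /= -Dn; ring.
rewrite /cost -big_split; apply: ler_sum => x _; rewrite -big_split; apply: ler_sum => y _ /=.
rewrite /pi mulrDl; apply: lerD; first by rewrite ler_wpM2r.
have := m10 x; rewrite le_eqVlt => /predU1P[<-|mx]; first by rewrite !mul0r.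
have := n10 y; rewrite le_eqVlt => /predU1P[<-|ny]; first by rewrite mulr0 !mul0r.
apply: ler_wpM2l; first by rewrite divr_ge0// mulr_ge0.
apply: dK.
  by apply: lt_le_trans mx _; rewrite lerBlDr lerDl sumr_ge0.
by apply: lt_le_trans ny _; rewrite lerBlDr lerDl sumr_ge0.
Qed.

End Transport.

(** * Graph distance and short walks *)

Section Distance.
Variables (N : nat) (G : graph N).
Implicit Types x y : 'I_N.

(** For k >= N this holds because [dist] never exceeds its default value [N]. *)
Lemma dist_le k x y : reach G k x y -> (dist G x y <= k)%N.
Proof.
move=> h; rewrite /dist; have [kN|kN] := ltnP k N; last first.
  apply: leq_trans kN; elim/big_rec: _ => // i m _ mN.
  by rewrite geq_min mN orbT.
pose k0 := Ordinal kN; have : k0 \in index_enum 'I_N by rewrite mem_index_enum.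
elim: (index_enum _) => //= i r IH; rewrite inE big_cons => /predU1P[<-|/IH le].
  by rewrite h geq_min leqnn.
by case: ifP => // _; rewrite geq_min le orbT.
Qed.

(** The default value [N] is the reason for [m <= N], and hence for the bounds on [N] in the
    curvature estimates. *)
Lemma dist_ge m x y : (m <= N)%N -> (forall k, (k < m)%N -> ~~ reach G k x y) ->
  (m <= dist G x y)%N.
Proof.
move=> mN h; rewrite /dist; elim/big_ind: _ => // [u v mu mv|i hi].
  by rewrite leq_min mu.
by rewrite leqNgt; apply: contraL hi => /h.
Qed.

Lemma reach1 x y : reach G 1 x y = adj G x y.
Proof.
apply/existsP/idP => [[z /andP[h /eqP <-]] //|h].
by exists y; rewrite h /=.
Qed.

Lemma reachS k x y z : adj G x z -> reach G k z y -> reach G k.+1 x y.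
Proof. by move=> h1 h2; apply/existsP; exists z; rewrite h1. Qed.

End Distance.

(** The vertices other than [a] and [b], and the paths of length 2, 3 and 4
    from [a] to [b] through pairwise distinct such vertices. *)
Section EdgeBounds.
Variables (N : nat) (R : realType) (G : graph N).
Implicit Types a b x y z : 'I_N.

Local Notation X x y := ((adj G x y)%:R : R).

Definition other a b x : bool := (x != a) && (x != b).

Lemma otherC a b x : other a b x = other b a x.
Proof. by rewrite /other andbC. Qed.

(** The shared edge is left out: given a-b, this count is binomial, and the counts at the two ends
    are independent. *)
Definition out_deg a b : nat := #|[pred x | other a b x && adj G a x]|.

Definition paths2 a b : R := \sum_(x | other a b x) (adj G a x && adj G x b)%:R.

(** Number of ways to complete a-x to a path a-x-y-b. *)
Definition ext3 a b x : R :=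
  \sum_(y | other a b y && (y != x)) (adj G x y && adj G y b)%:R.

Definition paths3 a b : R := \sum_(x | other a b x) X a x * ext3 a b x.

Definition ext4 a b x : R :=
  \sum_(y | other a b y && (y != x)) \sum_(z | other a b z && ((z != x) && (z != y)))
    [&& adj G x z, adj G z y & adj G y b]%:R.

Definition paths4 a b : R := \sum_(x | other a b x) X a x * ext4 a b x.

Lemma out_degE a b : (out_deg a b)%:R = \sum_(x | other a b x) X a x.
Proof.
rewrite /out_deg -sum1_card natr_sum big_mkcond /= [RHS]big_mkcond.
by apply: eq_bigr => x _; rewrite inE; case: other => //; case: adj.
Qed.

Lemma sum_other (V : zmodType) a b (F : 'I_N -> V) : a != b ->
  \sum_x F x = F a + F b + \sum_(x | other a b x) F x.
Proof.
move=> ab; rewrite (bigD1 a)//= (bigD1 b)//=; last by rewrite eq_sym.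
by rewrite addrA.
Qed.

Lemma card_other a b : a != b -> #|[pred x | other a b x]| = N.-2.
Proof.
move=> ab.
have := sum_other (fun=> 1%:R : int) ab; rewrite -!natr_sum !sum1_card card_ord -!natrD => h.
have : N = (2 + #|[pred x | other a b x]|)%N.
  by move/eqP: h; rewrite eqr_nat => /eqP.
by move=> {h} h; rewrite [in RHS]h.
Qed.

Section Edge.
Variables (a b : 'I_N).
Hypothesis Gab : adj G a b.

Let ab : a != b. Proof. exact: adj_neq Gab. Qed.

Lemma degE : deg G a = (out_deg a b).+1.
Proof.
rewrite /deg /out_deg -!sum1_card -add1n.
rewrite (bigD1 b) ?inE//=; congr (1 + _)%N; apply: eq_bigl => x.
by rewrite !inE /other; have [->|] := eqVneq x a; rewrite ?adjxx ?andbF//= andbC.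
Qed.

Lemma unifE x : unif_nbhd G a x = X a x / (out_deg a b).+1%:R.
Proof. by rewrite /unif_nbhd degE inE. Qed.

Lemma unif_sum (f : 'I_N -> R) : \sum_x f x * unif_nbhd G a x =
  (f b + \sum_(x | other a b x) f x * X a x) / (out_deg a b).+1%:R.
Proof.
under eq_bigr do rewrite unifE mulrA.
by rewrite -big_distrl (sum_other _ ab) adjxx Gab mulr0 mulr1 add0r.
Qed.

Lemma unif_ge0 x : 0 <= unif_nbhd G a x :> R.
Proof. by rewrite unifE divr_ge0. Qed.

Lemma unif_sum1 : \sum_x unif_nbhd G a x = 1 :> R.
Proof.
have := unif_sum (fun=> 1); under eq_bigr do rewrite mul1r; move=> ->.
under eq_bigr do rewrite mul1r.
by rewrite -out_degE nat1r divff ?pnatr_eq0.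
Qed.

Lemma unif_gt0 x : 0 < unif_nbhd G a x :> R -> adj G a x.
Proof. by rewrite unifE; case: adj => //; rewrite mul0r ltxx. Qed.

End Edge.

(** * Deterministic bounds on W1 in terms of degrees and numbers of short paths *)

Section Curvature.
Variables (a b : 'I_N).
Hypothesis Gab : adj G a b.

Let ab : a != b. Proof. exact: adj_neq Gab. Qed.
Let Gba : adj G b a. Proof. by rewrite adj_sym. Qed.
Let mu_ge0 x : 0 <= unif_nbhd G a x :> R. Proof. exact: (unif_ge0 Gab). Qed.
Let nu_ge0 x : 0 <= unif_nbhd G b x :> R. Proof. exact: (unif_ge0 Gba). Qed.
Let mu_sum1 : \sum_x unif_nbhd G a x = 1 :> R. Proof. exact: (unif_sum1 Gab). Qed.
Let nu_sum1 : \sum_x unif_nbhd G b x = 1 :> R. Proof. exact: (unif_sum1 Gba). Qed.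
Let da : R := (out_deg a b).+1%:R.
Let db : R := (out_deg b a).+1%:R.
Let da_gt0 : 0 < da. Proof. by rewrite ltr0n. Qed.
Let db_gt0 : 0 < db. Proof. by rewrite ltr0n. Qed.

Let daE : da = 1 + \sum_(x | other a b x) X a x.
Proof. by rewrite -out_degE nat1r. Qed.

Local Notation W := (W1 (dist G) (unif_nbhd G a) (unif_nbhd G b) : R).

Let W_ge_dual (f g : 'I_N -> R) :
  (forall x y, adj G a x -> adj G b y -> f x - g y <= (dist G x y)%:R) ->
  (f b + \sum_(x | other a b x) f x * X a x) / da
  - (g a + \sum_(y | other a b y) g y * X b y) / db <= W.
Proof.
move=> h.
have -> : \sum_(y | other a b y) g y * X b y = \sum_(y | other b a y) g y * X b y.
  exact: eq_bigl (otherC a b).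
rewrite /da /db -(unif_sum Gab f) -(unif_sum Gba g).
apply: W1_ge_dual => //.
by move=> x y /(unif_gt0 Gab) ? /(unif_gt0 Gba); apply: h.
Qed.

Let dist_ge1 x y : x != y -> 1 <= (dist G x y)%:R :> R.
Proof.
move=> xy; rewrite -[1]/(1%:R) ler_nat; apply: dist_ge; last by case.
by case: N x {xy} => [[]|].
Qed.

(** Potential 1 on N(a), lowered to 0 at the common neighbours: any other x in N(a) differs from
    every y in N(b). *)
Lemma W1_ge_paths2 : 1 - paths2 a b / da <= W.
Proof.
have := @W_ge_dual (fun x => 1 - X x b) (fun=> 0); rewrite adjxx subr0.
have -> : \sum_(y | other a b y) 0 * X b y = 0.
  by apply: big1 => *; rewrite mul0r.
rewrite addr0 mul0r subr0.
have -> : (1 + \sum_(x | other a b x) (1 - X x b) * X a x) / da = 1 - paths2 a b / da.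
  have -> : \sum_(x | other a b x) (1 - X x b) * X a x =
      \sum_(x | other a b x) X a x - paths2 a b.
    rewrite -sumrB; apply: eq_bigr => x _.
    by case: (adj G a x); case: (adj G x b) => /=; ring.
  by rewrite addrA -daE mulrBl divff ?gt_eqF.
apply=> x y ax by_; rewrite subr0; case: (boolP (adj G x b)) => [_|xb].
  by rewrite subrr.
by rewrite subr0; apply: dist_ge1; apply: contraNneq xb => ->; rewrite adj_sym.
Qed.

Let no_paths2 x : paths2 a b = 0 -> adj G a x -> adj G x b -> False.
Proof.
move=> h ax xb; move/eqP: h; rewrite psumr_eq0// => /allP/(_ x).
rewrite mem_index_enum ax xb /= oner_eq0 implybF => /(_ isT).
by rewrite /other (adj_neq xb) eq_sym (adj_neq ax).
Qed.

(** The potential f is 2 at the x of A without a path x-y-b, at most 0 at the others because [ext3]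
    is at least 1 there, and 0 at b; g is 1 at a, since x is adjacent to a. Without common
    neighbours, x in A and y in B are at distance at least 2 unless x-y is an edge, and then [ext3]
    is positive at x. *)
Lemma W1_ge_paths3 : (1 < N)%N -> paths2 a b = 0 ->
  2 * ((out_deg a b)%:R - paths3 a b) / da - db^-1 <= W.
Proof.
move=> N1 h2.
have := @W_ge_dual (fun x => if x == b then 0 else 2 * (1 - ext3 a b x))
   (fun y => (y == a)%:R).
rewrite !eqxx add0r.
have -> : \sum_(y | other a b y) (y == a)%:R * X b y = 0.
  by rewrite big1// => y /andP[/negPf -> _]; rewrite mul0r.
rewrite addr0 mul1r.
have -> : \sum_(x | other a b x) (if x == b then 0 else 2 * (1 - ext3 a b x)) * X a x =
    2 * ((out_deg a b)%:R - paths3 a b).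
  rewrite out_degE -sumrB big_distrr; apply: eq_bigr => x /andP[_ /negPf ->] /=; ring.
apply=> x y ax by_.
have yb : adj G y b by rewrite adj_sym.
have e0 : 0 <= ext3 a b x by apply: sumr_ge0.
have [xb|xb] := eqVneq x b.
  by apply: (@le_trans _ _ 0) => //; rewrite sub0r oppr_le0.
have xa : x != a by rewrite eq_sym (adj_neq ax).
have [->|ya] := eqVneq y a.
  by apply: (@le_trans _ _ 1); [rewrite /=; lra|exact: dist_ge1].
have xy : x != y by apply/eqP => xy; apply: (no_paths2 h2 ax); rewrite xy.
have [xy1|xy1] := boolP (adj G x y).
  have : 1 <= ext3 a b x.
    rewrite /ext3 (bigD1 y) /=; last by rewrite /other ya (adj_neq yb) eq_sym xy.
    by rewrite xy1 yb lerDl sumr_ge0.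
  by move=> h; apply: (@le_trans _ _ 0) => //=; lra.
apply: (@le_trans _ _ 2); first by rewrite /=; lra.
rewrite ler_nat; apply: dist_ge => // -[|[|]] // _; last by rewrite reach1.
Qed.

Let no_paths3 x y : paths3 a b = 0 -> adj G a x -> x != b -> adj G x y ->
  y != a -> adj G y b -> False.
Proof.
move=> + ax xb xy ya yb; have xo : other a b x by rewrite /other xb eq_sym (adj_neq ax).
move/eqP; rewrite psumr_eq0; last by move=> *; rewrite mulr_ge0// sumr_ge0.
move=> /allP/(_ x); rewrite mem_index_enum xo ax mul1r /= => /(_ isT).
rewrite psumr_eq0// => /allP/(_ y); rewrite mem_index_enum xy yb /= oner_eq0 implybF => /(_ isT).
by rewrite /other ya (adj_neq yb) eq_sym (adj_neq xy).
Qed.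

(** The same scheme with 3 in place of 2, and g a = 2 because 3 - 2 = 1. The value f b = 1 uses that
    b is at distance 1 from B; with it the bound for [paths4 = 0] is 3 - 2/da - 2/db, exactly the
    cost in [W1_le_tree]. *)
Lemma W1_ge_paths4 : (2 < N)%N -> paths2 a b = 0 -> paths3 a b = 0 ->
  (3 * ((out_deg a b)%:R - paths4 a b) + 1) / da - 2 / db <= W.
Proof.
move=> N2 h2 h3.
have := @W_ge_dual (fun x => if x == b then 1 else 3 * (1 - ext4 a b x))
   (fun y => 2 * (y == a)%:R).
rewrite !eqxx.
have -> : \sum_(y | other a b y) 2 * (y == a)%:R * X b y = 0.
  by rewrite big1// => y /andP[/negPf -> _]; rewrite mulr0 mul0r.
rewrite addr0 mulr1.
have -> : \sum_(x | other a b x) (if x == b then 1 else 3 * (1 - ext4 a b x)) * X a x =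
    3 * ((out_deg a b)%:R - paths4 a b).
  rewrite out_degE -sumrB big_distrr; apply: eq_bigr => x /andP[_ /negPf ->] /=; ring.
rewrite (addrC 1); apply=> x y ax by_.
have yb : adj G y b by rewrite adj_sym.
have e0 : 0 <= ext4 a b x by apply: sumr_ge0 => *; apply: sumr_ge0.
have [xb|xb] := eqVneq x b.
  have [_|ya] := eqVneq y a.
    by apply: (@le_trans _ _ 0) => //=; lra.
  rewrite mulr0 subr0; apply: dist_ge1; rewrite xb eq_sym; exact: adj_neq yb.
have xa : x != a by rewrite eq_sym (adj_neq ax).
have [->|ya] := eqVneq y a.
  by apply: (@le_trans _ _ 1); [rewrite /=; lra|exact: dist_ge1].
have xy : x != y by apply/eqP => xy; apply: (no_paths2 h2 ax); rewrite xy.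
have xy1 : ~~ adj G x y by apply/negP => xy1; exact: (no_paths3 h3 ax xb xy1 ya yb).
have [xy2|xy2] := boolP (reach G 2 x y).
  have [z /andP[xz zy']] := existsP xy2; have zy : adj G z y by rewrite -reach1.
  (* A midpoint equal to a would make y a common neighbour of a and b, and one equal to b would make
     x one. *)
  have za : z != a.
    by apply/eqP => za; apply: (@no_paths2 y) => //; rewrite -za.
  have zb : z != b.
    by apply/eqP => zb; apply: (@no_paths2 x) => //; rewrite -zb.
  have : 1 <= ext4 a b x.
    rewrite /ext4 (bigD1 y) /=; last by rewrite /other ya (adj_neq yb) eq_sym xy.
    rewrite (bigD1 z) /=; last by rewrite /other za zb (adj_neq zy) eq_sym (adj_neq xz).
    rewrite xz zy yb -addrA lerDl addr_ge0// sumr_ge0// => *; exact: sumr_ge0.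
  by move=> h; apply: (@le_trans _ _ 0) => //=; lra.
apply: (@le_trans _ _ 3); first by rewrite /=; lra.
rewrite ler_nat; apply: dist_ge => // -[|[|[|]]] // _; by rewrite reach1.
Qed.

Lemma dist_nbhd_le3 x y : adj G a x -> adj G b y -> (dist G x y <= 3)%N.
Proof.
move=> ax by_; apply: dist_le; apply: (reachS (z := a)); first by rewrite adj_sym.
by apply: (reachS Gab); rewrite reach1.
Qed.

Lemma W1_nbhd_le3 : W <= 3.
Proof.
apply: W1_le_diam => //.
move=> x y /(unif_gt0 Gab) ax /(unif_gt0 Gba) by_.
by rewrite ler_nat dist_nbhd_le3.
Qed.

(** If one endpoint has no other neighbour, its measure is a point mass at the other endpoint, at
    distance 1 from the whole second support; there are no common neighbours, so the cost is not
    below 1. *)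
Lemma ricci_leaf : (out_deg a b == 0)%N || (out_deg b a == 0)%N -> ricci G a b = 0 :> R.
Proof.
move=> h; rewrite /ricci.
have h2 : paths2 a b = 0.
  apply: big1 => x xo; have nox u v : out_deg u v = 0%N -> other u v x -> adj G u x = false.
    move=> /eqP; rewrite -(pnatr_eq0 R) out_degE psumr_eq0// => /allP/(_ x).
    rewrite mem_index_enum => /(_ isT) + ox; rewrite ox /=.
    by case: adj => //; rewrite oner_eq0.
  case/orP: h => /eqP/nox; first by move=> /(_ xo) ->.
  by rewrite -otherC => /(_ xo) h; rewrite (adj_sym G x) h andbF.
apply/eqP; rewrite subr_eq0 eq_sym eq_le; apply/andP; split; last first.
  by have := W1_ge_paths2; rewrite h2 mul0r subr0.
apply: W1_le_diam => //.
move=> x y /(unif_gt0 Gab) ax /(unif_gt0 Gba) by_.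
have only u v w : out_deg u v = 0%N -> adj G u w -> w = v.
  move=> /eqP; rewrite -(pnatr_eq0 R) out_degE psumr_eq0// => /allP/(_ w).
  rewrite mem_index_enum => /(_ isT) + uw; rewrite uw oner_eq0 implybF /other.
  by rewrite (eq_sym w u) (adj_neq uw) /= negbK => /eqP.
rewrite -[leRHS]/(1%:R) ler_nat; apply: dist_le; rewrite reach1.
by case/orP: h => /eqP/only; [move=> /(_ _ ax) ->|move=> /(_ _ by_) ->; rewrite adj_sym].
Qed.

(** The mass 1/da of b is spread evenly over B and the mass 1/db of a is collected evenly from A,
    both at distance 1; the remaining t = 1 - 1/da - 1/db goes from A to B at distance at most 3.
    Since both degrees are at least 2, t is nonnegative. *)
Lemma W1_le_tree : (0 < out_deg a b)%N -> (0 < out_deg b a)%N ->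
  W <= 3 - 2 / da - 2 / db.
Proof.
move=> pa pb.
pose al : R := (out_deg a b)%:R; pose be : R := (out_deg b a)%:R.
have al0 : 1 <= al by rewrite -[1]/(1%:R) ler_nat.
have be0 : 1 <= be by rewrite -[1]/(1%:R) ler_nat.
have da' : da = al + 1 by rewrite /da -natr1.
have db' : db = be + 1 by rewrite /db -natr1.
pose t := 1 - da^-1 - db^-1.
have t0 : 0 <= t.
  have : da^-1 <= 2^-1 by rewrite lef_pV2 ?posrE//; lra.
  have : db^-1 <= 2^-1 by rewrite lef_pV2 ?posrE//; lra.
  rewrite /t; move: da^-1 db^-1 => u v h1 h2; lra.
pose xA x : R := (other a b x)%:R * X a x; pose xB y : R := (other a b y)%:R * X b y.
have sA : \sum_x xA x = al.
  rewrite /al out_degE [RHS]big_mkcond; apply: eq_bigr => x _.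
  by rewrite /xA; case: other; rewrite ?mul1r ?mul0r.
have sB : \sum_x xB x = be.
  rewrite /be out_degE [RHS]big_mkcond; apply: eq_bigr => x _.
  by rewrite /xB otherC; case: other; rewrite ?mul1r ?mul0r.
have xA0 x : 0 <= xA x by rewrite mulr_ge0.
have xB0 x : 0 <= xB x by rewrite mulr_ge0.
have seq1 (v : 'I_N) : \sum_x (x == v)%:R = 1 :> R.
  by rewrite (bigD1 v)//= eqxx big1 ?addr0// => x /negPf ->.
have aE x : X a x = xA x + (x == b)%:R.
  rewrite /xA /other; have [->|xb] := eqVneq x b; first by rewrite Gab andbF mul0r add0r.
  by have [->|xa] := eqVneq x a; rewrite ?adjxx /= ?mul1r ?mul0r addr0.
have bE x : X b x = xB x + (x == a)%:R.
  rewrite /xB /other; have [->|xb] := eqVneq x a; first by rewrite Gba mul0r add0r.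
  by have [->|xa] := eqVneq x b; rewrite ?adjxx /= ?mul1r ?mul0r addr0.
pose pi x y := (x == b)%:R * xB y / (da * be) + xA x * (y == a)%:R / (db * al)
   + xA x * xB y * (t / (al * be)).
have al_n0 : al != 0 by apply: lt0r_neq0; lra.
have be_n0 : be != 0 by apply: lt0r_neq0; lra.
have cpi : coupling (unif_nbhd G a) (unif_nbhd G b) pi.
  split=> [x y|x|y].
  - rewrite !addr_ge0// ?divr_ge0 ?mulr_ge0 ?divr_ge0 ?mulr_ge0 ?invr_ge0 ?mulr_ge0//; try lra;
    exact: ltW.
  - rewrite !big_split /= -!big_distrl -!big_distrr /= sB seq1 (unifE Gab) -/da aE /t.
    rewrite da' db'; field; rewrite -da' -db' al_n0 be_n0 ?gt_eqF//.
  - rewrite !big_split /= -!big_distrl /= sA seq1 (unifE Gba) -/db bE /t.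
    rewrite da' db'; field; rewrite -da' -db' al_n0 be_n0 ?gt_eqF//.
apply: le_trans (W1_le_cost _ cpi) _.
(* The plan weighted by the distance bounds 1, 1 and 3 of its three pieces; its total is the claimed
   cost. *)
pose pi' x y := (x == b)%:R * xB y / (da * be) + xA x * (y == a)%:R / (db * al)
   + xA x * xB y * (t / (al * be)) * 3.
apply: (@le_trans _ _ (\sum_x \sum_y pi' x y)); last first.
  under eq_bigr do (rewrite !big_split /= -!big_distrl -!big_distrr /= sB seq1).
  rewrite !big_split /= -!big_distrl /= sA seq1 /t.
  rewrite da' db' le_eqVlt; apply/orP; left; apply/eqP.
  by field; rewrite -da' -db' al_n0 be_n0 ?gt_eqF.
apply: ler_sum => x _; apply: ler_sum => y _.
have sup (u v : 'I_N -> R) (k : nat) (c : R) : 0 <= c ->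
    (forall x, 0 <= u x) -> (forall y, 0 <= v y) ->
    (u x != 0 -> v y != 0 -> (dist G x y <= k)%N) ->
    u x * v y * c * (dist G x y)%:R <= u x * v y * c * k%:R.
  move=> c0 u0 v0 h; have [->|ux] := eqVneq (u x) 0; first by rewrite !mul0r.
  have [->|vy] := eqVneq (v y) 0; first by rewrite mulr0 !mul0r.
  by rewrite ler_wpM2l ?mulr_ge0// ler_nat h.
have xAn0 u : xA u != 0 -> adj G a u by rewrite /xA; case: adj => //; rewrite mulr0 eqxx.
have xBn0 u : xB u != 0 -> adj G b u by rewrite /xB; case: adj => //; rewrite mulr0 eqxx.
rewrite /pi /pi' 2!mulrDl; apply: lerD; first apply: lerD.
- rewrite -[leRHS]mulr1; apply: (sup (fun x => (x == b)%:R) xB 1%N) => //.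
    by rewrite invr_ge0 mulr_ge0// ltW// (lt_le_trans ltr01).
  have [->|_] := eqVneq x b; last by rewrite eqxx.
  move=> _ /xBn0 by_.
  by apply: dist_le; rewrite reach1.
- rewrite -[leRHS]mulr1; apply: (sup xA (fun y => (y == a)%:R) 1%N) => //.
    by rewrite invr_ge0 mulr_ge0// ltW// (lt_le_trans ltr01).
  move=> /xAn0 ax; have [-> _|_] := eqVneq y a; last by rewrite eqxx.
  by apply: dist_le; rewrite reach1 adj_sym.
- apply: (sup xA xB 3%N (t / (al * be))) => //.
    by rewrite divr_ge0// mulr_ge0// (le_trans ler01).
  by move=> /xAn0 ax /xBn0 by_; exact: dist_nbhd_le3.
Qed.

(** The lower and upper bounds coincide. The positive part in [Ylimit] covers the case of a leaf,
    where 1 - 1/da - 1/db is negative. *)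
Lemma ricci_tree : (2 < N)%N -> paths2 a b = 0 -> paths3 a b = 0 -> paths4 a b = 0 ->
  ricci G a b = Ylimit R (out_deg a b) (out_deg b a).
Proof.
move=> N2 h2 h3 h4; rewrite /Ylimit !nat1r -/da -/db.
have i1 (k : nat) : (k.+1%:R)^-1 <= 1 :> R.
  by rewrite invf_le1 ?ltr0n// -[1]/(1%:R) ler_nat.
have [h|] := boolP ((out_deg a b == 0)%N || (out_deg b a == 0)%N).
  rewrite ricci_leaf// max_l ?mulr0//; case/orP: h => /eqP h.
    have -> : da = 1 by rewrite /da h.
    by have := invr_ge0 db; rewrite (ltW db_gt0) invr1; move: db^-1 => v v0; lra.
  have -> : db = 1 by rewrite /db h.
  by have := invr_ge0 da; rewrite (ltW da_gt0) invr1; move: da^-1 => v v0; lra.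
rewrite negb_or -!lt0n => /andP[pa pb].
have Wle := W1_le_tree pa pb; have := W1_ge_paths4 N2 h2 h3; rewrite h4 subr0.
have -> : (out_deg a b)%:R = da - 1 by rewrite /da -natr1 addrK.
have -> : (3 * (da - 1) + 1) / da = 3 - 2 / da.
  by field; rewrite gt_eqF.
move=> Wge.
have ha : da^-1 <= 2^-1 by rewrite lef_pV2 ?posrE// ler_nat.
have hb : db^-1 <= 2^-1 by rewrite lef_pV2 ?posrE// ler_nat.
move: ha hb Wle Wge; rewrite /ricci.
move: da^-1 db^-1 W => u v w hu hv wle wge.
by rewrite max_r; lra.
Qed.

(** Upper estimate of the l^1 distance from [row] to the uniform measure around u, with the random
    degree replaced by a deterministic scale s, later np. The last term pays for the mass at v,
    where [row] is 0, and for the difference of 1 between degree and [out_deg]. *)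
Definition row_defect u v (row : 'I_N -> R) (s : R) : R :=
  \sum_(x | other u v x) `|row x - X u x / s| + `|(out_deg u v)%:R / s - 1|
  + 2 / (out_deg u v).+1%:R.

Lemma sum_row_defect u v (row : 'I_N -> R) (s : R) : adj G u v -> 0 < s ->
  row u = 0 -> row v = 0 ->
  \sum_x `|row x - unif_nbhd G u x| <= row_defect u v row s.
Proof.
move=> uv s0 ru rv; rewrite (sum_other _ (adj_neq uv)) !(unifE uv) ru rv uv adjxx.
set du : R := (out_deg u v).+1%:R; have du0 : 0 < du by rewrite ltr0n.
have duE : (out_deg u v)%:R = du - 1 by rewrite /du -natr1 addrK.
rewrite mul0r subr0 normr0 add0r sub0r normrN div1r (ger0_norm (x := du^-1)); last by rewrite invr_ge0 ltW.
have h1 : \sum_(x | other u v x) `|row x - unif_nbhd G u x| <=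
    \sum_(x | other u v x) `|row x - X u x / s| +
    \sum_(x | other u v x) X u x * `|s^-1 - du^-1|.
  rewrite -big_split; apply: ler_sum => x _; rewrite (unifE uv) -/du /=.
  have -> : X u x * `|s^-1 - du^-1| = `|X u x / s - X u x / du|.
    by rewrite -mulrBr normrM ger0_norm.
  rewrite -[leLHS](_ : `|(row x - X u x / s) + (X u x / s - X u x / du)| = _).
    exact: ler_normD.
  by congr `|_|; ring.
have h2 : \sum_(x | other u v x) X u x * `|s^-1 - du^-1| <=
    `|(out_deg u v)%:R / s - 1| + du^-1.
  rewrite -big_distrl /= -out_degE -[V in V * _]ger0_norm// -normrM mulrBr.
  have -> : (out_deg u v)%:R / s - (out_deg u v)%:R / du =
     ((out_deg u v)%:R / s - 1) + du^-1.
    by rewrite duE; field; rewrite !gt_eqF.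
  by apply: le_trans (ler_normD _ _) _; rewrite lerD2l ger0_norm// invr_ge0 ltW.
apply: le_trans (lerD (lexx _) (le_trans h1 (lerD (lexx _) h2))) _.
by rewrite /row_defect -/du; move: du^-1 => w; lra.
Qed.

(** L is the distance covered by the plan and e the saving from mass that stays put. The total mass
    exceeds 1 by at most the row defect, which accounts for the summand L of L + 3; the repair
    accounts for the 3, as all distances involved are at most 3. *)
Lemma W1_le_row_defect (pi0 : 'I_N -> 'I_N -> R) (s L e : R) : 0 < s -> 0 <= L ->
  (forall x y, 0 <= pi0 x y) ->
  (forall x y, ~~ (other a b x && other a b y) -> pi0 x y = 0) ->
  \sum_x \sum_y pi0 x y * (dist G x y)%:R <= L * (\sum_x \sum_y pi0 x y) - e ->
  W <= L - e + (L + 3) * (row_defect a b (fun x => \sum_y pi0 x y) s +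
                          row_defect b a (fun y => \sum_x pi0 x y) s).
Proof.
move=> s0 L0 pi00 pio hc.
have := W1_le_approx_coupling (d := dist G) mu_ge0 nu_ge0 mu_sum1 nu_sum1 (K := 3) _ _ pi00.
have d3 : forall x y, 0 < unif_nbhd G a x :> R -> 0 < unif_nbhd G b y :> R -> (dist G x y)%:R <= 3 :> R.
  move=> x y /(unif_gt0 Gab) ax /(unif_gt0 Gba) by_.
  by rewrite ler_nat dist_nbhd_le3.
move=> /(_ _ d3); have -> : 0 <= 3 :> R by []. move=> /(_ isT) h.
have zr x : ~~ other a b x -> \sum_y pi0 x y = 0.
  by move=> hx; apply: big1 => y _; apply: pio; rewrite (negPf hx).
have zc y : ~~ other a b y -> \sum_x pi0 x y = 0.
  by move=> hy; apply: big1 => x _; apply: pio; rewrite (negPf hy) andbF.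
have oa : ~~ other a b a by rewrite /other eqxx.
have ob : ~~ other a b b by rewrite /other eqxx andbF.
have ra := sum_row_defect (row := fun x => \sum_y pi0 x y) Gab s0 (zr _ oa) (zr _ ob).
have rb := sum_row_defect (row := fun y => \sum_x pi0 x y) Gba s0 (zc _ ob) (zc _ oa).
have tot : \sum_x \sum_y pi0 x y <= 1 + row_defect a b (fun x => \sum_y pi0 x y) s.
  apply: (@le_trans _ _ (1 + \sum_x `|\sum_y pi0 x y - unif_nbhd G a x|)); last by rewrite lerD2l.
  rewrite -lerBlDl -[V in _ - V]mu_sum1 -sumrB; apply: ler_sum => x _; exact: ler_norm.
have rb0 : 0 <= row_defect b a (fun y => \sum_x pi0 x y) s by apply: le_trans rb; exact: sumr_ge0.
move: h ra rb hc tot rb0.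
set c1 := \sum_x \sum_y pi0 x y * _; set c2 := \sum_x \sum_y pi0 x y.
set r1 := row_defect _ _ _ _; set r2 := row_defect _ _ _ _.
set q1 := \sum_x _; set q2 := \sum_y _ => h ra rb hc tot rb0.
have := ler_wpM2l L0 tot; have := mulr_ge0 L0 rb0; lra.
Qed.

End Curvature.
End EdgeBounds.

(** * Almost couplings that put equal mass on every path *)

Section PathCouplings.
Variables (N : nat) (R : realType) (G : graph N).
Implicit Types a b x y z : 'I_N.

Local Notation X x y := ((adj G x y)%:R : R).

Definition row4 (c : R) a b x : R := c * X a x * ext4 R G a b x.

(** Paths ending in a y not adjacent to a: a common neighbour y keeps its own mass and must not
    receive more. With the factor 1 - X x b in [row3], this makes the plan symmetric under
    exchanging a and b. *)
Definition excl_ext3 a b x : R :=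
  \sum_(y | other a b y && (y != x)) [&& adj G x y, adj G y b & ~~ adj G a y]%:R.

Definition row3 (c s : R) a b x : R :=
  X a x * X x b / s + c * X a x * (1 - X x b) * excl_ext3 a b x.

Lemma eq_row_defect a b (r r' : 'I_N -> R) s : (forall x, other a b x -> r x = r' x) ->
  row_defect G a b r s = row_defect G a b r' s.
Proof. by move=> rr'; congr (_ + _ + _); apply: eq_bigr => x /rr' ->. Qed.

Section Edge.
Variables (a b : 'I_N).
Hypothesis Gab : adj G a b.

Local Notation W := (W1 (dist G) (unif_nbhd G a) (unif_nbhd G b) : R).

(** The pair x, y receives c times its number of midpoints z, and is then at distance at most 2.
    Read backwards, a path a-x-z-y-b runs from b to a, so the columns are again a [row4]. The
    constant is 5 = 2 + 3. *)
Lemma W1_le_row4 (c s : R) : 0 <= c -> 0 < s ->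
  W <= 2 + 5 * (row_defect G a b (row4 c a b) s + row_defect G b a (row4 c b a) s).
Proof.
move=> c0 s0.
pose pi0 x y : R := if other a b x && other a b y && (y != x) then
  c * X a x * X b y * \sum_(z | other a b z && ((z != x) && (z != y))) (adj G x z && adj G z y)%:R
  else 0.
have := @W1_le_row_defect N R G a b Gab pi0 s 2 0 s0 _ _ _ _.
have -> : row_defect G a b (fun x => \sum_y pi0 x y) s = row_defect G a b (row4 c a b) s.
  apply: eq_row_defect => x xo; rewrite /row4 /ext4 big_distrr /= [RHS]big_mkcond.
  apply: eq_bigr => y _; rewrite /pi0 xo /=; case: ifP => // _.
  rewrite -mulrA; congr (_ * _); rewrite big_distrr /=; apply: eq_bigr => z _.
  by rewrite (adj_sym G b y); do 3 case: adj; rewrite /= ?mulr0 ?mulr1.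
have -> : row_defect G b a (fun y => \sum_x pi0 x y) s = row_defect G b a (row4 c b a) s.
  apply: eq_row_defect => y yo; rewrite /row4 /ext4 big_distrr /= [RHS]big_mkcond.
  apply: eq_bigr => x _; rewrite /pi0 !(otherC a b) yo andbT eq_sym; case: ifP => // _.
  rewrite -!mulrA; congr (_ * _); rewrite mulrCA; congr (_ * _).
  rewrite big_distrr /= (eq_bigl (fun z => other b a z && ((z != y) && (z != x)))); last first.
    by move=> z; rewrite otherC; congr (_ && _); rewrite andbC.
  apply: eq_bigr => z _.
  rewrite (adj_sym G a x) (adj_sym G x z) (adj_sym G z y).
  by do 3 case: adj; rewrite /= ?mulr0 ?mulr1.
have pi00 x y : 0 <= pi0 x y.
  by rewrite /pi0; case: ifP => // _; rewrite !mulr_ge0// sumr_ge0.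
rewrite !subr0 [2 + 3](_ : _ = 5); last by ring.
apply=> //.
- by move=> x y /negPf h; rewrite /pi0 h.
- rewrite mulrC big_distrl /=; apply: ler_sum => x _.
  rewrite big_distrl /=; apply: ler_sum => y _.
  have [->|] := eqVneq (pi0 x y) 0; first by rewrite !mul0r.
  rewrite /pi0; case: ifP => _ h; last by rewrite !mul0r.
  rewrite ler_wpM2l//.
    by rewrite !mulr_ge0// sumr_ge0.
  rewrite ler_nat; apply: dist_le; apply: contraNT h => hr.
  rewrite big1 ?mulr0// => z _.
  case: (boolP (adj G x z)) => //= xz; case: (boolP (adj G z y)) => //= zy.
  by case/negP: hr; apply: (reachS xz); rewrite reach1.
Qed.

(** Off the diagonal, mass sits only on edges x-y and travels distance 1. The diagonal mass,
    [paths2] / s in total, travels distance 0 and is the saving. The constant is 4 = 1 + 3. *)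
Lemma W1_le_row3 (c s : R) : 0 <= c -> 0 < s ->
  W <= 1 - paths2 R G a b / s
       + 4 * (row_defect G a b (row3 c s a b) s + row_defect G b a (row3 c s b a) s).
Proof.
move=> c0 s0.
pose pi0 x y : R := if other a b x && other a b y then
  if y == x then X a x * X x b / s else
  c * X a x * (1 - X x b) * [&& adj G x y, adj G y b & ~~ adj G a y]%:R
  else 0.
have sumE u v x (F : 'I_N -> R) : other u v x ->
    \sum_y (if other u v y then F y else 0) = F x + \sum_(y | other u v y && (y != x)) F y.
  by move=> xo; rewrite -big_mkcond (bigD1 x).
have := @W1_le_row_defect N R G a b Gab pi0 s 1 (paths2 R G a b / s) s0 _ _ _ _.
have -> : row_defect G a b (fun x => \sum_y pi0 x y) s = row_defect G a b (row3 c s a b) s.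
  apply: eq_row_defect => x xo; rewrite /pi0 xo /= (sumE _ _ x)// eqxx; congr (_ + _).
  by rewrite /excl_ext3 big_distrr /=; apply: eq_bigr => y /andP[_ /negPf ->].
have -> : row_defect G b a (fun y => \sum_x pi0 x y) s = row_defect G b a (row3 c s b a) s.
  apply: eq_row_defect => y yo; rewrite /pi0.
  transitivity (\sum_x (if other b a x then (if y == x then X a x * X x b / s else
     c * X a x * (1 - X x b) * [&& adj G x y, adj G y b & ~~ adj G a y]%:R) else 0)).
    by apply: eq_bigr => x _; rewrite !(otherC a b) yo andbT.
  rewrite (sumE _ _ y)// eqxx; congr (_ + _).
    by rewrite (adj_sym G a) (adj_sym G b) [X y a * _]mulrC.
  rewrite /excl_ext3 big_distrr /=; apply: eq_bigr => x /andP[_].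
  rewrite eq_sym => /negPf ->.
  rewrite (adj_sym G a x) (adj_sym G a y) (adj_sym G x b) (adj_sym G x y) (adj_sym G y b).
  by do 5 case: adj => /=; ring.
have pi00 x y : 0 <= pi0 x y.
  rewrite /pi0; case: ifP => // _; case: ifP => // _.
    by rewrite divr_ge0 ?mulr_ge0// ltW.
  by rewrite !mulr_ge0//; case: adj; rewrite ?subrr ?subr0.
rewrite [1 + 3](_ : _ = 4); last by ring.
apply=> //.
- by move=> x y /negPf h; rewrite /pi0 h.
- rewrite mul1r /paths2 big_distrl /= (big_mkcond (other a b)) -sumrB; apply: ler_sum => x _.
  rewrite (bigD1 x)//= [V in _ <= V - _](bigD1 x)//=.
  have -> : dist G x x = 0%N by apply/eqP; rewrite -leqn0; apply: dist_le => /=.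
  rewrite mulr0 add0r.
  have -> : pi0 x x = if other a b x then (adj G a x && adj G x b)%:R / s else 0.
    by rewrite /pi0 andbb eqxx -natrM mulnb.
  rewrite addrAC subrr add0r; apply: ler_sum => y /negPf yx.
  have [->|] := eqVneq (pi0 x y) 0; first by rewrite !mul0r.
  rewrite /pi0 yx; case: ifP => _ h; last by rewrite !mul0r.
  rewrite ler_piMr//.
    by rewrite !mulr_ge0//; case: adj; rewrite ?subrr ?subr0.
  rewrite -[leRHS]/(1%:R) ler_nat; apply: dist_le; rewrite reach1.
  by apply: contraNT h => /negPf -> /=; rewrite mulr0.
Qed.

End Edge.
End PathCouplings.

(** Evaluates [indep_lits] on an explicit list from the inequalities between vertices in the
    context. *)
Ltac indep_lits_tac :=
  rewrite /indep_lits /same_pair /=;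
  repeat match goal with
  | H : is_true (?x != ?y) |- context [?x == ?y] => rewrite (negPf H)
  | H : is_true (?x != ?y) |- context [?y == ?x] => rewrite (eq_sym y x) (negPf H)
  end;
  rewrite ?eqxx ?andbF ?orbF //=.

(** * First and second moments; exactly n vertices differ from a and b *)

Section Moments.
Variables (n : nat) (R : realType) (p : R) (a b : 'I_n.+2).
Hypotheses (p01 : 0 < p <= 1) (ab : a != b).
Implicit Types (G : graph n.+2) (x y z : 'I_n.+2).

Local Notation E := (cond_exp p a b).
Local Notation X G x y := ((adj G x y)%:R : R).
Local Notation nR := (n%:R : R).

Let p_gt0 : 0 < p. Proof. by case/andP: p01. Qed.
Let p_le1 : p <= 1. Proof. by case/andP: p01. Qed.

Lemma cond_exp_bool (f : pred (graph n.+2)) s : indep_lits ((a, b, true) :: s) ->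
  (forall G, f G = all (holds G) s) ->
  E (fun G => (f G)%:R) = \prod_(l <- s) lit_weight p l.2.
Proof. by move=> hs fs; rewrite -(cond_exp_lits p01 ab hs); apply: eq_cond_exp => G _; rewrite fs. Qed.

Lemma cond_exp_bool_le (f : pred (graph n.+2)) s : indep_lits ((a, b, true) :: s) ->
  (forall G, f G -> all (holds G) s) ->
  E (fun G => (f G)%:R) <= \prod_(l <- s) lit_weight p l.2.
Proof.
move=> hs fs; rewrite -(cond_exp_lits p01 ab hs); apply: ler_cond_exp => // G _.
by rewrite ler_nat; case: (f G) (fs G) => // ->.
Qed.

Lemma sum_other_cst (c : R) : \sum_(x | other a b x) c = nR * c.
Proof.
have := card_other ab; rewrite /= => h; rewrite big_const h iter_addr_0.
by rewrite mulr_natl.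
Qed.

Lemma sum_other1_cst x (c : R) : other a b x ->
  \sum_(y | other a b y && (y != x)) c = (nR - 1) * c.
Proof.
move=> xo; have := sum_other_cst c; rewrite (bigD1 x)//= => h.
by rewrite mulrBl -h mul1r addrAC subrr add0r.
Qed.

Lemma sum_other2_cst x y (c : R) : other a b x -> other a b y -> y != x ->
  \sum_(z | other a b z && ((z != x) && (z != y))) c = (nR - 2) * c.
Proof.
move=> xo yo yx; have := sum_other1_cst c xo; rewrite (bigD1 y) ?yo//= => h.
have -> : (nR - 2) * c = (nR - 1) * c - c by ring.
by rewrite -h addrAC subrr add0r; apply: eq_bigl => z; rewrite andbA.
Qed.

Lemma sum_other_le (P : pred 'I_n.+2) (F : 'I_n.+2 -> R) : (forall x, 0 <= F x) ->
  \sum_(x | other a b x && P x) F x <= \sum_(x | other a b x) F x.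
Proof.
move=> F0; rewrite big_mkcondr; apply: ler_sum => x _; by case: (P x).
Qed.

(** Expansion of the square about M, a convenient approximation to the mean. The first moment enters
    with a negative sign, so a lower bound on it serves. *)
Lemma weighted_variance (W : pred (graph n.+2)) (T : graph n.+2 -> R) (w t1 t2 M : R) :
  0 < M -> E (fun G => (W G)%:R) = w -> w * t1 <= E (fun G => (W G)%:R * T G) ->
  E (fun G => (W G)%:R * (T G * T G)) <= w * t2 ->
  E (fun G => (W G)%:R * (T G / M - 1) ^+ 2) <= w * (t2 / M ^+ 2 - 2 * t1 / M + 1).
Proof.
move=> M0 hw h1 h2.
have -> : E (fun G => (W G)%:R * (T G / M - 1) ^+ 2) =
   M ^- 2 * E (fun G => (W G)%:R * (T G * T G)) + (- 2 / M) * E (fun G => (W G)%:R * T G) + w.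
  rewrite -hw -!cond_expZ -!cond_expD; apply: eq_cond_exp => G _.
  by field; rewrite gt_eqF.
have -> : w * (t2 / M ^+ 2 - 2 * t1 / M + 1) = M ^- 2 * (w * t2) + (- 2 / M) * (w * t1) + w.
  by field; rewrite gt_eqF.
rewrite lerD2r; apply: lerD.
  by rewrite ler_wpM2l// invr_ge0 exprn_ge0// ltW.
by rewrite ler_wnM2l// mulNr oppr_le0 divr_ge0// ltW.
Qed.

(** Given [W], the events [F i] have probability m and are pairwise independent, so the second
    moment is at most k m + k^2 m^2. Here k is n or n - 1 while the scale is always n m; the factor
    2 absorbs the mismatch. *)
Lemma pair_sum_variance (D : pred 'I_n.+2) (W : pred (graph n.+2))
    (F : 'I_n.+2 -> pred (graph n.+2)) (w m k : R) :
  0 <= w -> 0 < m <= 1 -> (forall c, \sum_(i | D i) c = k * c) ->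
  nR - 1 <= k <= nR -> 0 < nR ->
  E (fun G => (W G)%:R) = w ->
  (forall i, D i -> E (fun G => (W G && F i G)%:R) = w * m) ->
  (forall i j, D i -> D j -> j != i -> E (fun G => [&& W G, F i G & F j G]%:R) = w * m ^+ 2) ->
  E (fun G => (W G)%:R * ((\sum_(i | D i) (F i G)%:R) / (nR * m) - 1) ^+ 2)
    <= w * (2 / (nR * m)).
Proof.
move=> w0 /andP[m0 m1] kE /andP[kn1 kn] n0 hW h1 h2.
have M0 : 0 < nR * m by rewrite mulr_gt0.
apply: (@le_trans _ _ (w * ((k * m + k ^+ 2 * m ^+ 2) / (nR * m) ^+ 2 - 2 * (k * m) / (nR * m) + 1))).
  apply: weighted_variance => //.
  - under [leRHS]eq_cond_exp do rewrite big_distrr /=.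
    rewrite cond_exp_sum (eq_bigr (fun=> w * m)); last first.
      move=> i Di; rewrite -(h1 _ Di); apply: eq_cond_exp => G _.
      by rewrite -natrM mulnb.
    by rewrite kE; lra.
  - have -> : E (fun G => (W G)%:R * ((\sum_(i | D i) (F i G)%:R) * (\sum_(i | D i) (F i G)%:R)))
      = \sum_(i | D i) \sum_(j | D j) E (fun G => [&& W G, F i G & F j G]%:R).
      under [RHS]eq_bigr do rewrite -cond_exp_sum.
      rewrite -cond_exp_sum; apply: eq_cond_exp => G _.
      rewrite big_distrl big_distrr; apply: eq_bigr => i _ /=.
      rewrite big_distrr big_distrr; apply: eq_bigr => j _ /=.
      by rewrite -!natrM !mulnb.
    have -> : w * (k * m + k ^+ 2 * m ^+ 2) = \sum_(i | D i) (w * m + k * (w * m ^+ 2)).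
      by rewrite kE; ring.
    apply: ler_sum => i Di; rewrite (bigD1 i)//=; apply: lerD.
      by rewrite -(h1 _ Di) le_eqVlt; apply/orP; left; apply/eqP/eq_cond_exp => G _; rewrite andbb.
    rewrite -kE big_mkcondr; apply: ler_sum => j Dj; case: ifP => [ji|_].
      by rewrite h2.
    by rewrite mulr_ge0// exprn_ge0// ltW.
apply: ler_wpM2l => //.
(* The difference is nonnegative because m (n - k)^2 <= 1 <= n. *)
rewrite -subr_ge0.
have -> : 2 / (nR * m) - ((k * m + k ^+ 2 * m ^+ 2) / (nR * m) ^+ 2 - 2 * (k * m) / (nR * m) + 1)
  = ((nR - k) * m + m * (nR - m * (nR - k) ^+ 2)) / (nR * m) ^+ 2.
  by field; rewrite !gt_eqF.
rewrite divr_ge0 ?exprn_ge0//; last exact: ltW.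
have n1 : 1 <= nR by move: n0; rewrite ltr0n => h; rewrite -[1]/(1%:R) ler_nat.
rewrite addr_ge0 ?mulr_ge0 ?subr_ge0//; [exact: ltW|exact: ltW|].
apply: le_trans n1; rewrite mulr_ile1 ?exprn_ge0 ?expr_le1//; lra.
Qed.

Lemma E_out_deg : E (fun G => (out_deg G a b)%:R) = nR * p.
Proof.
under eq_cond_exp do rewrite out_degE.
rewrite cond_exp_sum -sum_other_cst; apply: eq_bigr => x /andP[xa xb].
rewrite (@cond_exp_bool _ [:: (a, x, true)]); first by rewrite big_seq1.
  by indep_lits_tac.
by move=> G; rewrite /= /holds eqb_id andbT.
Qed.

Lemma var_out_deg : 0 < nR ->
  E (fun G => ((out_deg G a b)%:R / (nR * p) - 1) ^+ 2) <= 2 / (nR * p).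
Proof.
move=> n0; rewrite -[leRHS]mul1r.
rewrite (@eq_cond_exp _ _ _ _ _ _ (fun G => (predT G)%:R *
    ((\sum_(x | other a b x) X G a x) / (nR * p) - 1) ^+ 2)); last first.
  by move=> G _; rewrite mul1r -out_degE.
apply: (@pair_sum_variance (other a b) predT (fun x G => adj G a x) 1 p nR) => //.
- exact: sum_other_cst.
- by rewrite lexx andbT; lra.
- by rewrite cond_exp_cst.
- move=> x /andP[xa xb]; rewrite mul1r (@cond_exp_bool _ [:: (a, x, true)]) ?big_seq1//.
    by indep_lits_tac.
  by move=> G; rewrite /= /holds eqb_id andbT.
- move=> x y /andP[xa xb] /andP[ya yb] yx.
  rewrite mul1r (@cond_exp_bool _ [:: (a, x, true); (a, y, true)]).
  + by rewrite big_cons big_seq1 expr2.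
  + by indep_lits_tac.
  + by move=> G; rewrite /= /holds !eqb_id andbT.
Qed.

Lemma E_paths2 : E (fun G => paths2 R G a b) = nR * p ^+ 2.
Proof.
rewrite cond_exp_sum -sum_other_cst; apply: eq_bigr => x /andP[xa xb].
rewrite (@cond_exp_bool _ [:: (a, x, true); (x, b, true)]).
- by rewrite big_cons big_seq1 expr2.
- by indep_lits_tac.
- by move=> G; rewrite /= /holds !eqb_id andbT.
Qed.

Lemma var_paths2 : 0 < nR ->
  E (fun G => (paths2 R G a b / (nR * p ^+ 2) - 1) ^+ 2) <= 2 / (nR * p ^+ 2).
Proof.
move=> n0; rewrite -[leRHS]mul1r.
have p2 : 0 < p ^+ 2 <= 1 by rewrite exprn_gt0//= expr_le1// ltW.
rewrite (@eq_cond_exp _ _ _ _ _ _ (fun G => (predT G)%:R *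
    (paths2 R G a b / (nR * p ^+ 2) - 1) ^+ 2)); last by move=> G _; rewrite mul1r.
apply: (@pair_sum_variance (other a b) predT (fun x G => adj G a x && adj G x b) 1 (p ^+ 2) nR)
   => //.
- exact: sum_other_cst.
- by rewrite lexx andbT; lra.
- by rewrite cond_exp_cst.
- move=> x /andP[xa xb]; rewrite mul1r (@cond_exp_bool _ [:: (a, x, true); (x, b, true)]).
  + by rewrite big_cons big_seq1 expr2.
  + by indep_lits_tac.
  + by move=> G; rewrite /= /holds !eqb_id andbT.
- move=> x y /andP[xa xb] /andP[ya yb] yx.
  rewrite mul1r (@cond_exp_bool _ [:: (a, x, true); (x, b, true); (a, y, true); (y, b, true)]).
  + by rewrite !big_cons big_nil /=; ring.
  + by indep_lits_tac.
  + by move=> G; rewrite /= /holds !eqb_id andbT !andbA.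
Qed.

Lemma E_paths3 : 0 < nR -> E (fun G => paths3 R G a b) <= nR ^+ 2 * p ^+ 3.
Proof.
move=> n0; rewrite cond_exp_sum.
have -> : nR ^+ 2 * p ^+ 3 = \sum_(x | other a b x) nR * p ^+ 3 by rewrite sum_other_cst; ring.
apply: ler_sum => x xo; under eq_cond_exp do rewrite big_distrr /=.
rewrite cond_exp_sum -sum_other_cst.
apply: le_trans (sum_other_le (fun y => y != x) _); last by move=> _; rewrite exprn_ge0// ltW.
apply: ler_sum => y /andP[/andP[ya yb] yx]; case/andP: xo => xa xb.
rewrite (@eq_cond_exp _ _ _ _ _ _ (fun G => [&& adj G a x, adj G x y & adj G y b]%:R)); last first.
  by move=> G _; rewrite -natrM mulnb.
rewrite (@cond_exp_bool _ [:: (a, x, true); (x, y, true); (y, b, true)]).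
- by rewrite !big_cons big_nil /=; lra.
- by indep_lits_tac.
- by move=> G; rewrite /= /holds !eqb_id andbT.
Qed.

(** For distinct y the conditions use disjoint sets of edges, none of them a-x, so the general
    variance bound applies with m = p^2 (1 - p). *)
Lemma var_excl_ext3 x : other a b x -> p < 1 -> 0 < nR ->
  E (fun G => X G a x * (excl_ext3 R G a b x / (nR * (p ^+ 2 * (1 - p))) - 1) ^+ 2)
  <= p * (2 / (nR * (p ^+ 2 * (1 - p)))).
Proof.
move=> xo plt1 n0; have p2 : 0 < p ^+ 2 * (1 - p) <= 1.
  rewrite mulr_gt0 ?exprn_gt0 ?subr_gt0//= mulr_ile1 ?exprn_ge0 ?expr_le1//; try exact: ltW;
  by move: p_gt0 plt1 => ? ?; lra.
have /andP[xa xb] := xo.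
apply: (@pair_sum_variance (fun y => other a b y && (y != x)) (fun G => adj G a x)
  (fun y G => [&& adj G x y, adj G y b & ~~ adj G a y]) p _ (nR - 1)) => //.
- exact: ltW.
- by move=> c; exact: sum_other1_cst.
- by rewrite lexx /=; lra.
- rewrite (@cond_exp_bool _ [:: (a, x, true)]) ?big_seq1//.
    by indep_lits_tac.
  by move=> G; rewrite /= /holds eqb_id andbT.
- move=> y /andP[/andP[ya yb] yx].
  rewrite (@cond_exp_bool _ [:: (a, x, true); (x, y, true); (y, b, true); (a, y, false)]).
  + by rewrite !big_cons big_nil /=; ring.
  + by indep_lits_tac.
  + by move=> G; rewrite /= /holds /= !eqb_id !eqbF_neg andbT.
- move=> y z /andP[/andP[ya yb] yx] /andP[/andP[za zb] zx] zy.
  rewrite (@cond_exp_bool _ [:: (a, x, true); (x, y, true); (y, b, true); (a, y, false);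
     (x, z, true); (z, b, true); (a, z, false)]).
  + by rewrite !big_cons big_nil /=; ring.
  + by indep_lits_tac.
  + by move=> G; rewrite /= /holds /= !eqb_id !eqbF_neg andbT !andbA.
Qed.

End Moments.

(** * Second moment of the number of paths x-z-y-b, which may share edges *)

Section PathsOfLength4.
Variables (n : nat) (R : realType) (p : R) (a b : 'I_n.+2).
Hypotheses (p01 : 0 < p <= 1) (ab : a != b).
Implicit Types (G : graph n.+2) (x y z : 'I_n.+2).

Local Notation E := (cond_exp p a b).
Local Notation X G x y := ((adj G x y)%:R : R).
Local Notation nR := (n%:R : R).

Let p_gt0 : 0 < p. Proof. by case/andP: p01. Qed.
Let p_ge0 : 0 <= p. Proof. exact: ltW. Qed.

Lemma E_ext4 x : other a b x ->
  E (fun G => X G a x * ext4 R G a b x) = p * ((nR - 1) * (nR - 2) * p ^+ 3).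
Proof.
move=> xo; under eq_cond_exp do rewrite big_distrr /=.
rewrite cond_exp_sum.
have -> : p * ((nR - 1) * (nR - 2) * p ^+ 3) =
    \sum_(y | other a b y && (y != x)) (nR - 2) * p ^+ 4.
  by rewrite sum_other1_cst//; ring.
apply: eq_bigr => y /andP[yo yx]; under eq_cond_exp do rewrite big_distrr /=.
rewrite cond_exp_sum -(sum_other2_cst ab _ xo yo yx); apply: eq_bigr => z.
move: xo yo => /andP[xa xb] /andP[ya yb] /andP[/andP[za zb] /andP[zx zy]].
rewrite (@eq_cond_exp _ _ _ _ _ _
  (fun G => [&& adj G a x, adj G x z, adj G z y & adj G y b]%:R)); last first.
  by move=> G _; rewrite -natrM mulnb.
rewrite (cond_exp_bool p01 ab (s := [:: (a, x, true); (x, z, true); (z, y, true); (y, b, true)])).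
- by rewrite !big_cons big_nil /=; ring.
- by indep_lits_tac.
- by move=> G; rewrite /= /holds !eqb_id andbT.
Qed.

Lemma E_paths4 : 2 <= nR -> E (fun G => paths4 R G a b) <= nR ^+ 3 * p ^+ 4.
Proof.
move=> n2; rewrite cond_exp_sum.
rewrite (eq_bigr (fun=> p * ((nR - 1) * (nR - 2) * p ^+ 3))); last by move=> x /E_ext4.
rewrite sum_other_cst// -subr_ge0.
have -> : nR ^+ 3 * p ^+ 4 - nR * (p * ((nR - 1) * (nR - 2) * p ^+ 3)) =
   nR * p ^+ 4 * (3 * nR - 2) by ring.
by rewrite !mulr_ge0// ?exprn_ge0//; lra.
Qed.

(* Two paths x-z-y-b and x-z'-y'-b share an edge only if y = y', z = z' or they
   traverse the edge {y, z} in opposite directions. *)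
Lemma E_two_paths x y z y' z' : other a b x -> other a b y -> other a b z ->
  other a b y' -> other a b z' -> y != x -> z != x -> z != y ->
  y' != x -> z' != x -> z' != y' ->
  E (fun G => [&& adj G a x, [&& adj G x z, adj G z y & adj G y b]
                & [&& adj G x z', adj G z' y' & adj G y' b]]%:R) <=
  p * (p ^+ 6 + (y' == y)%:R * p ^+ 5 + (z' == z)%:R * p ^+ 5
       + (y' == z)%:R * (z' == y)%:R * p ^+ 5 + (y' == y)%:R * (z' == z)%:R * p ^+ 3).
Proof.
move=> /andP[xa xb] /andP[ya yb] /andP[za zb] /andP[y'a y'b] /andP[z'a z'b].
move=> yx zx zy y'x z'x z'y'.
have pow0 k : 0 <= p ^+ k by rewrite exprn_ge0.
have [ey|ny] := eqVneq y' y; have [ez|nz] := eqVneq z' z.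
- rewrite {}ey {}ez.
  apply: (@le_trans _ _ (p * p ^+ 3)); last first.
    rewrite ler_pM2l// !mul1r; have := pow0 5; have := pow0 6.
    by rewrite ?(eq_sym y z) (negPf zy) ?mulr0 ?mul0r; lra.
  apply: le_trans (cond_exp_bool_le p01 ab
    (s := [:: (a, x, true); (x, z, true); (z, y, true); (y, b, true)]) _ _) _.
  + by indep_lits_tac.
  + by move=> G; rewrite /= /holds !eqb_id andbT => /and3P[-> -> _].
  + by rewrite !big_cons big_nil /=; lra.
- rewrite {}ey in z'y' *.
  apply: (@le_trans _ _ (p * p ^+ 5)); last first.
    rewrite ler_pM2l// !mul1r !mul0r; have := pow0 5; have := pow0 6.
    by rewrite ?(eq_sym y z) (negPf zy) ?mulr0 ?mul0r; lra.
  apply: le_trans (cond_exp_bool_le p01 ab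
    (s := [:: (a, x, true); (x, z, true); (z, y, true); (y, b, true); (x, z', true); (z', y, true)])
    _ _) _.
  + by indep_lits_tac.
  + by move=> G; rewrite /= /holds !eqb_id andbT => /and3P[-> /and3P[-> -> ->] /and3P[-> -> _]].
  + by rewrite !big_cons big_nil /=; lra.
- rewrite {}ez in z'y' *.
  apply: (@le_trans _ _ (p * p ^+ 5)); last first.
    rewrite ler_pM2l// !mul1r !mul0r; have := pow0 5; have := pow0 6.
    by rewrite ?(eq_sym y z) (negPf zy) ?mulr0 ?mul0r; lra.
  apply: le_trans (cond_exp_bool_le p01 ab
    (s := [:: (a, x, true); (x, z, true); (z, y, true); (y, b, true); (z, y', true); (y', b, true)])
    _ _) _.
  + by indep_lits_tac.
  + by move=> G; rewrite /= /holds !eqb_id andbT => /and3P[-> /and3P[-> -> ->] /and3P[_ -> ->]].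
  + by rewrite !big_cons big_nil /=; lra.
- have [/andP[/eqP ey /eqP ez]|nsw] := boolP ((y' == z) && (z' == y)).
    rewrite {}ey {}ez.
    apply: (@le_trans _ _ (p * p ^+ 5)); last first.
      by rewrite ler_pM2l// !eqxx !mul1r !mul0r; have := pow0 6; lra.
    apply: le_trans (cond_exp_bool_le p01 ab
      (s := [:: (a, x, true); (x, z, true); (z, y, true); (y, b, true); (x, y, true); (z, b, true)])
      _ _) _.
    + by indep_lits_tac.
    + by move=> G; rewrite /= /holds !eqb_id andbT => /and3P[-> /and3P[-> -> ->] /and3P[-> _ ->]].
    + by rewrite !big_cons big_nil /=; lra.
  rewrite -natrM mulnb (negPf nsw) !mul0r !addr0.
  rewrite (cond_exp_bool p01 ab (s := [:: (a, x, true); (x, z, true); (z, y, true); (y, b, true);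
    (x, z', true); (z', y', true); (y', b, true)])).
  + by rewrite !big_cons big_nil /=; lra.
  + by rewrite negb_and in nsw; case/orP: nsw => nsw; indep_lits_tac.
  + by move=> G; rewrite /= /holds !eqb_id andbT !andbA.
Qed.

(** Sum of [E_two_paths] over both paths. Sharing y or z costs one factor n and one edge, giving n^3
    p^5 each; equal paths give n^2 p^3. The reversed middle edge gives n^2 p^5, absorbed by raising
    the coefficient of n^3 p^5 from 2 to 3. *)
Lemma E_ext4_sqr x : other a b x -> 0 < nR ->
  E (fun G => X G a x * (ext4 R G a b x * ext4 R G a b x)) <=
  p * (nR ^+ 4 * p ^+ 6 + 3 * nR ^+ 3 * p ^+ 5 + nR ^+ 2 * p ^+ 3).
Proof.
move=> xo n0.
pose F y z G := [&& adj G x z, adj G z y & adj G y b].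
pose D y z := other a b z && ((z != x) && (z != y)).
have -> : E (fun G => X G a x * (ext4 R G a b x * ext4 R G a b x)) =
  \sum_(y | other a b y && (y != x)) \sum_(z | D y z)
  \sum_(y' | other a b y' && (y' != x)) \sum_(z' | D y' z')
     E (fun G => [&& adj G a x, F y z G & F y' z' G]%:R).
  under [RHS]eq_bigr => y _.
    under eq_bigr => z _.
      under eq_bigr => y' _ do rewrite -cond_exp_sum.
      rewrite -cond_exp_sum; over.
    rewrite -cond_exp_sum; over.
  rewrite -cond_exp_sum; apply: eq_cond_exp => G _.
  rewrite big_distrl big_distrr; apply: eq_bigr => y _ /=.
  rewrite big_distrl big_distrr; apply: eq_bigr => z _ /=.
  rewrite big_distrr big_distrr; apply: eq_bigr => y' _ /=.
  rewrite big_distrr big_distrr; apply: eq_bigr => z' _ /=.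
  by rewrite -!natrM !mulnb.
have pow0 k : 0 <= p ^+ k by rewrite exprn_ge0.
pose B := p * (nR ^+ 2 * p ^+ 6 + 2 * nR * p ^+ 5 + p ^+ 5 + p ^+ 3).
have B0 : 0 <= B by rewrite mulr_ge0// !addr_ge0// !mulr_ge0.
have inner y z : other a b y && (y != x) -> D y z ->
  \sum_(y' | other a b y' && (y' != x)) \sum_(z' | D y' z')
     E (fun G => [&& adj G a x, F y z G & F y' z' G]%:R) <= B.
  move=> /andP[yo yx] /andP[zo /andP[zx zy]].
  pose Q y' z' : R := p * (p ^+ 6 + (y' == y)%:R * p ^+ 5 + (z' == z)%:R * p ^+ 5
       + (y' == z)%:R * (z' == y)%:R * p ^+ 5 + (y' == y)%:R * (z' == z)%:R * p ^+ 3).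
  have Q0 y' z' : 0 <= Q y' z' by rewrite mulr_ge0// !addr_ge0// !mulr_ge0.
  have d1 u : other a b u -> \sum_(v | other a b v) (v == u)%:R = 1 :> R.
    move=> uo; rewrite (bigD1 u)//= eqxx big1 ?addr0// => v /andP[_ /negPf ->] //.
  apply: (@le_trans _ _ (\sum_(y' | other a b y') \sum_(z' | other a b z') Q y' z')).
    apply: le_trans (sum_other_le a b (fun y => y != x) _); last by move=> ?; apply: sumr_ge0.
    apply: ler_sum => y' /andP[y'o y'x].
    apply: le_trans (sum_other_le a b (fun z => (z != x) && (z != y')) _) => //.
    apply: ler_sum => z' /andP[z'o /andP[z'x z'y']].
    exact: E_two_paths.
  have sQ y' : \sum_(z' | other a b z') Q y' z' =
      p * (nR * p ^+ 6 + (y' == y)%:R * (nR * p ^+ 5 + p ^+ 3) + p ^+ 5 + (y' == z)%:R * p ^+ 5).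
    rewrite -big_distrr /=; congr (_ * _).
    rewrite !big_split /= -!big_distrl /= -!big_distrr /= !d1// !sum_other_cst//.
    by ring.
  rewrite (eq_bigr _ (fun y' _ => sQ y')) -big_distrr /= /B ler_pM2l//.
  rewrite !big_split /= -!big_distrl /= !d1// !sum_other_cst//.
  by lra.
apply: (@le_trans _ _ (nR * (nR * B))).
  rewrite -(sum_other_cst ab); apply: le_trans (sum_other_le a b (fun y => y != x) _); last first.
    by move=> _; rewrite mulr_ge0// ltW.
  apply: ler_sum => y hy; rewrite -(sum_other_cst ab).
  apply: le_trans (sum_other_le a b (fun z => (z != x) && (z != y)) _) => //.
  by apply: ler_sum => z hz; exact: inner.
rewrite -subr_ge0 /B.
have -> : p * (nR ^+ 4 * p ^+ 6 + 3 * nR ^+ 3 * p ^+ 5 + nR ^+ 2 * p ^+ 3) -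
  nR * (nR * (p * (nR ^+ 2 * p ^+ 6 + 2 * nR * p ^+ 5 + p ^+ 5 + p ^+ 3)))
  = p ^+ 6 * nR ^+ 2 * (nR - 1) by ring.
apply: mulr_ge0; first by rewrite mulr_ge0 ?exprn_ge0.
by rewrite subr_ge0 -[1]/(1%:R) ler_nat; move: n0; rewrite ltr0n.
Qed.

(** The first two terms are n^3 p^5 and n^2 p^3 relative to (n^2 p^3)^2; the term 6/n comes from (n
    - 1)(n - 2) standing in for n^2 in the mean. *)
Lemma var_ext4 x : other a b x -> 0 < nR ->
  E (fun G => X G a x * (ext4 R G a b x / (nR ^+ 2 * p ^+ 3) - 1) ^+ 2)
  <= p * (3 / (nR * p) + 1 / (nR ^+ 2 * p ^+ 3) + 6 / nR).
Proof.
move=> xo n0; have M0 : 0 < nR ^+ 2 * p ^+ 3 by rewrite mulr_gt0 ?exprn_gt0.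
have /andP[xa xb] := xo.
have hw : E (fun G => X G a x) = p.
  rewrite (cond_exp_bool p01 ab (s := [:: (a, x, true)])) ?big_seq1//.
    by indep_lits_tac.
  by move=> G; rewrite /= /holds eqb_id andbT.
have := weighted_variance M0 hw (t1 := (nR - 1) * (nR - 2) * p ^+ 3) _ (E_ext4_sqr xo n0).
rewrite E_ext4// lexx => /(_ isT) /le_trans; apply; apply: ler_wpM2l => //.
rewrite -subr_ge0.
have -> : 3 / (nR * p) + 1 / (nR ^+ 2 * p ^+ 3) + 6 / nR -
  ((nR ^+ 4 * p ^+ 6 + 3 * nR ^+ 3 * p ^+ 5 + nR ^+ 2 * p ^+ 3) / (nR ^+ 2 * p ^+ 3) ^+ 2 -
   2 * ((nR - 1) * (nR - 2) * p ^+ 3) / (nR ^+ 2 * p ^+ 3) + 1) = 4 / nR ^+ 2.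
  by field; rewrite !gt_eqF.
by rewrite divr_ge0// exprn_ge0// ltW.
Qed.

End PathsOfLength4.

(** * Elementary limits of real sequences *)

Lemma cvg0_near (R : realType) (u : nat -> R) :
  (forall e : R, 0 < e -> \forall n \near \oo, `|u n| <= e) -> u n @[n --> \oo] --> (0 : R).
Proof.
move=> h; apply/cvgr0Pnorm_le => e e0; exact: h.
Qed.

Lemma cvg0_squeeze (R : realType) (u v : nat -> R) :
  (\forall n \near \oo, 0 <= u n <= v n) -> v n @[n --> \oo] --> (0 : R) ->
  u n @[n --> \oo] --> (0 : R).
Proof. by move=> h hv; apply: (@squeeze_cvgr _ _ _ _ (fun=> 0) v) => //; exact: cvg_cst. Qed.

Lemma cvg0D (R : realType) (u v : nat -> R) :
  u n @[n --> \oo] --> (0 : R) -> v n @[n --> \oo] --> (0 : R) ->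
  u n + v n @[n --> \oo] --> (0 : R).
Proof. by move=> hu hv; rewrite -[0]addr0; exact: cvgD. Qed.

Lemma cvg0Mr (R : realType) (c : R) (u : nat -> R) :
  u n @[n --> \oo] --> (0 : R) -> u n * c @[n --> \oo] --> (0 : R).
Proof. by move=> hu; rewrite -(mul0r c); apply: cvgM hu _; exact: cvg_cst. Qed.

Lemma cvgy_div0 (R : realType) (c : R) (u : nat -> R) : 0 <= c ->
  u n @[n --> \oo] --> +oo -> c / u n @[n --> \oo] --> (0 : R).
Proof.
move=> c0 /cvgryPge hu; apply: cvg0_near => e e0.
near=> n.
have h : c / e + 1 <= u n by near: n; exact: hu.
have u0 : 0 < u n by apply: lt_le_trans h; rewrite ltr_pwDr// divr_ge0// ltW.
rewrite ger0_norm ?divr_ge0 ?(ltW u0)// ler_pdivrMr// mulrC -ler_pdivrMr//.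
by apply: le_trans h; rewrite lerDl.
Unshelve. all: by end_near. Qed.

(** * Events of probability 1 - o(1) *)

Section Asymptotics.
Variables (R : realType) (p : nat -> R) (a b : forall n, 'I_n.+2).
Hypotheses (hab : forall n, a n != b n) (hp : forall n, 0 < p n <= 1).

Let p_gt0 n : 0 < p n. Proof. by case/andP: (hp n). Qed.

Definition whp (P : forall n, pred (graph n.+2)) : Prop :=
  cond_prob (p n) (a n) (b n) (fun G => ~~ P n G) @[n --> \oo] --> (0 : R).

Lemma whp_sub (P Q : forall n, pred (graph n.+2)) :
  (\forall n \near \oo, forall G, adj G (a n) (b n) -> P n G -> Q n G) -> whp P -> whp Q.
Proof.
move=> PQ; apply: cvg0_squeeze; near=> n.
rewrite cond_prob_ge0//=; apply: le_cond_prob => // G hG; apply: contraNN.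
by move: G hG; near: n.
Unshelve. all: by end_near. Qed.

Lemma whp_and (P Q : forall n, pred (graph n.+2)) :
  whp P -> whp Q -> whp (fun n G => P n G && Q n G).
Proof.
move=> hP hQ; apply: cvg0_squeeze (cvg0D hP hQ); near=> n.
rewrite cond_prob_ge0//=; apply: le_trans (cond_probU _ _ _ _) => //.
by apply: le_cond_prob => // G _; rewrite negb_and.
Unshelve. all: by end_near. Qed.

Lemma whp_markov (f : forall n, graph n.+2 -> R) (u : nat -> R) (c : R) : 0 < c ->
  (forall n G, adj G (a n) (b n) -> 0 <= f n G) ->
  (\forall n \near \oo, cond_exp (p n) (a n) (b n) (f n) <= u n) ->
  u n @[n --> \oo] --> (0 : R) -> whp (fun n G => f n G <= c).
Proof.
move=> c0 f0 fu hu; apply: cvg0_squeeze (cvg0Mr c^-1 hu); near=> n; rewrite cond_prob_ge0//=.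
apply: le_trans (cond_prob_markov (hp n) (hab n) c0 (@f0 n)) _.
by rewrite ler_pM2r ?invr_gt0//; near: n.
Unshelve. all: by end_near. Qed.

Lemma whp_conv_in_prob (X : forall n, graph n.+2 -> R) (c : R) :
  (forall e, 0 < e -> whp (fun n G => `|X n G - c| <= e)) -> conv_in_prob p a b X c.
Proof.
move=> h e e0; have := h e e0; rewrite /whp.
by under eq_fun do (under eq_fun do rewrite -ltNge).
Qed.

(** The theorem counts all n + 2 vertices, the moments only the n others; n + 2 <= 3n for n >= 1
    makes the difference a factor 3^k. *)
Lemma cvgy_scale k (u : nat -> R) : (forall n, 0 <= u n) ->
  n.+2%:R ^+ k * u n @[n --> \oo] --> +oo -> n%:R ^+ k * u n @[n --> \oo] --> +oo.
Proof.
move=> u0 /cvgryPge h; apply/cvgryPge => A.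
near=> n.
have hA : 3 ^+ k * A <= n.+2%:R ^+ k * u n by near: n; exact: h.
have n1 : (0 < n)%N by near: n; exists 1%N.
rewrite -(ler_pM2l (exprn_gt0 k (ltr0n R 3))) (le_trans hA)// mulrA -exprMn -natrM.
by rewrite ler_wpM2r// lerXn2r ?nnegrE// ler_nat; lia.
Unshelve. all: by end_near. Qed.

Lemma cvg0_scale k (u : nat -> R) : (forall n, 0 <= u n) ->
  n.+2%:R ^+ k * u n @[n --> \oo] --> (0 : R) -> n%:R ^+ k * u n @[n --> \oo] --> (0 : R).
Proof.
move=> u0; apply: cvg0_squeeze; near=> n.
by rewrite mulr_ge0 ?exprn_ge0//= ler_wpM2r// lerXn2r ?nnegrE// ler_nat; lia.
Unshelve. all: by end_near. Qed.

Local Notation np n := (n%:R * p n).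
Local Notation oA n G := ((out_deg G (a n) (b n))%:R : R).
Local Notation oB n G := ((out_deg G (b n) (a n))%:R : R).

Let near_gt0 : \forall n \near \oo, 0 < (n%:R : R).
Proof. by near=> n; rewrite ltr0n; near: n; exists 1%N. Unshelve. all: by end_near. Qed.

Let norm_le_sqr (t d : R) : 0 <= d -> (t ^+ 2 <= d ^+ 2) = (`|t| <= d).
Proof. by move=> d0; rewrite -[t ^+ 2]real_normK ?num_real// ler_pXn2r// nnegrE. Qed.

Lemma whp_out_deg d : 0 < d -> np n @[n --> \oo] --> +oo ->
  whp (fun n G => `|oA n G / np n - 1| <= d).
Proof.
move=> d0 hnp.
have d2 : 0 < d ^+ 2 by exact: exprn_gt0.
apply: whp_sub (whp_markov (f := fun n G => (oA n G / np n - 1) ^+ 2)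
  d2 _ _ (cvgy_div0 (ler0n R 2) hnp)) => //.
- by apply: nearW => n G _; rewrite norm_le_sqr// ltW.
- by move=> n G _; exact: sqr_ge0.
- by near=> n; apply: var_out_deg => //; near: n; exact: near_gt0.
Unshelve. all: by end_near. Qed.

Lemma whp_inv_deg d : 0 < d -> np n @[n --> \oo] --> +oo ->
  whp (fun n G => ((out_deg G (a n) (b n)).+1%:R^-1 : R) <= d).
Proof.
move=> d0 hnp; have h2 : 0 < (2^-1 : R) by [].
apply: whp_sub (whp_out_deg h2 hnp); near=> n => G _ h.
have hn : 2 / d <= np n by near: n; move/cvgryPge : hnp; exact.
have np0 : 0 < np n by apply: lt_le_trans hn; rewrite divr_gt0.
rewrite invf_ple ?posrE//; apply: (@le_trans _ _ (np n / 2)).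
  by rewrite ler_pdivlMr// mulrC.
apply: (@le_trans _ _ (oA n G)); last by rewrite ler_nat.
move: h; rewrite ler_norml => /andP[h _].
have {}h : 2^-1 <= oA n G / np n by lra.
by rewrite ler_pdivlMr// mulrC in h.
Unshelve. all: by end_near. Qed.

(** The degree is at least np/2 with high probability, so it is enough to control the ratio to the
    deterministic np, to which Markov's inequality applies. *)
Lemma whp_over_deg (f : forall n, graph n.+2 -> R) d : 0 < d ->
  np n @[n --> \oo] --> +oo -> (forall n G, 0 <= f n G) ->
  (forall e, 0 < e -> whp (fun n G => f n G / np n <= e)) ->
  whp (fun n G => f n G / (out_deg G (a n) (b n)).+1%:R <= d).
Proof.
move=> d0 hnp f0 hf; have h2 : 0 < (2^-1 : R) by [].
have d2 : 0 < d / 2 by rewrite divr_gt0.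
apply: whp_sub (whp_and (whp_out_deg h2 hnp) (hf _ d2)); near=> n => G _ /andP[h1 h3].
have hn : 1 <= np n by near: n; move/cvgryPge : hnp; exact.
have np0 : 0 < np n by exact: lt_le_trans hn.
rewrite ler_pdivrMr ?ltr0n//; rewrite ler_pdivrMr// in h3; apply: le_trans h3 _.
rewrite -mulrA ler_pM2l//.
move: h1; rewrite ler_norml => /andP[h _].
have {}h : 2^-1 <= oA n G / np n by lra.
rewrite ler_pdivlMr// in h; apply: le_trans h _.
by rewrite ler_nat.
Unshelve. all: by end_near. Qed.

(** Path counts are integers, so Markov's inequality at level 1/2 makes them vanish. *)
Let natr_lt1 (m : nat) : (m%:R : R) <= 2^-1 -> m = 0%N.
Proof.
case: m => // m h; have := le_trans (_ : 1 <= m.+1%:R :> R) h.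
by rewrite -[1]/(1%:R) ler_nat => /(_ isT) h'; exfalso; lra.
Qed.

Lemma whp_paths2 : n%:R * p n ^+ 2 @[n --> \oo] --> (0 : R) ->
  whp (fun n G => paths2 R G (a n) (b n) == 0).
Proof.
move=> h; have h2 : 0 < (2^-1 : R) by [].
apply: whp_sub (whp_markov (f := fun n G => paths2 R G (a n) (b n)) h2 _ _ h).
- apply: nearW => n G _ /=; rewrite /paths2 -natr_sum => /natr_lt1 ->; exact: eqxx.
- by move=> n G _; apply: sumr_ge0.
- by apply: nearW => n; rewrite E_paths2.
Qed.

Lemma paths3_ge0 n (G : graph n.+2) u v : 0 <= paths3 R G u v.
Proof. by apply: sumr_ge0 => x _; rewrite mulr_ge0// sumr_ge0. Qed.

Lemma paths4_ge0 n (G : graph n.+2) u v : 0 <= paths4 R G u v.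
Proof.
by apply: sumr_ge0 => x _; rewrite mulr_ge0// sumr_ge0// => y _; rewrite sumr_ge0.
Qed.

Lemma whp_paths3 : n%:R ^+ 2 * p n ^+ 3 @[n --> \oo] --> (0 : R) ->
  whp (fun n G => paths3 R G (a n) (b n) == 0).
Proof.
move=> h; have h2 : 0 < (2^-1 : R) by [].
apply: whp_sub (whp_markov (f := fun n G => paths3 R G (a n) (b n)) h2 _ _ h).
- apply: nearW => n G _ /=; rewrite /paths3 /ext3.
  under eq_bigr do rewrite -natr_sum -natrM.
  by rewrite -natr_sum => /natr_lt1 ->.
- by move=> n G _; exact: paths3_ge0.
- by near=> n; rewrite E_paths3//; near: n; exact: near_gt0.
Unshelve. all: by end_near. Qed.

(** Here [U] is the number of paths out of x divided by its mean order and p V bounds its variance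
    on the event a-x. Each of the n terms then has expectation at most e/n once V <= e^2, so the
    whole l^1 error is small in mean. *)
Lemma whp_row_sum (U : forall n, graph n.+2 -> 'I_n.+2 -> R)
    (row : forall n, graph n.+2 -> 'I_n.+2 -> R) (V : nat -> R) d : 0 < d ->
  (forall n G x, other (a n) (b n) x -> `|row n G x - (adj G (a n) x)%:R / np n| <=
                  (adj G (a n) x)%:R * `|U n G x - 1| / np n) ->
  (\forall n \near \oo, forall x, other (a n) (b n) x ->
     cond_exp (p n) (a n) (b n) (fun G => (adj G (a n) x)%:R * (U n G x - 1) ^+ 2)
     <= p n * V n) ->
  V n @[n --> \oo] --> (0 : R) ->
  whp (fun n G => \sum_(x | other (a n) (b n) x)
        `|row n G x - (adj G (a n) x)%:R / np n| <= d).
Proof.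
move=> d0 hrow hV V0.
pose S n (G : graph n.+2) : R := \sum_(x | other (a n) (b n) x)
        `|row n G x - (adj G (a n) x)%:R / np n|.
have S0 n G : adj G (a n) (b n) -> 0 <= S n G by move=> _; exact: sumr_ge0.
apply: (@whp_markov S (fun n => cond_exp (p n) (a n) (b n) (S n)) _ d0 S0).
  exact: nearW.
apply: cvg0_near => e e0; near=> n.
have n0 : 0 < (n%:R : R) by near: n; exact: near_gt0.
have np0 : 0 < np n by rewrite mulr_gt0.
have Ve : V n <= e ^+ 2.
  apply: le_trans (ler_norm _) _; near: n.
  by apply: cvgr0_norm_le => //; exact: exprn_gt0.
rewrite ger0_norm; last by apply: cond_exp_ge0 => //; exact: S0.
rewrite /S cond_exp_sum.
apply: (@le_trans _ _ (\sum_(x | other (a n) (b n) x) e / n%:R)); last first.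
  by rewrite sum_other_cst// mulrC divfK// gt_eqF.
apply: ler_sum => x xo.
(* AM-GM: [2 e |u| <= e^2 + u^2] *)
apply: (@le_trans _ _ (cond_exp (p n) (a n) (b n) (fun G =>
   (2 * np n)^-1 * (e * (adj G (a n) x)%:R + e^-1 * ((adj G (a n) x)%:R * (U n G x - 1) ^+ 2))))).
  apply: ler_cond_exp => // G _; apply: le_trans (hrow _ _ _ xo) _.
  case: (adj G (a n) x); rewrite /= ?(mul0r, mulr0, addr0, mul1r, mulr1)//.
  rewrite -subr_ge0; set t := `|_|.
  have -> : (U n G x - 1) ^+ 2 = t ^+ 2 by rewrite /t real_normK// num_real.
  have -> : (2 * np n)^-1 * (e + e^-1 * t ^+ 2) - t / np n =
    (2 * np n * e)^-1 * (e - t) ^+ 2 by field; rewrite !gt_eqF.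
  by rewrite mulr_ge0 ?sqr_ge0// invr_ge0 !mulr_ge0// ltW.
rewrite cond_expZ cond_expD !cond_expZ.
have -> : cond_exp (p n) (a n) (b n) (fun G => (adj G (a n) x)%:R) = p n.
  have /andP[xa xb] := xo; have abn := hab n.
  rewrite (cond_exp_bool (hp n) (hab n) (s := [:: (a n, x, true)])) ?big_seq1//.
    by indep_lits_tac.
  by move=> G; rewrite /= /holds eqb_id andbT.
apply: (@le_trans _ _ ((2 * np n)^-1 * (e * p n + e^-1 * (p n * e ^+ 2)))).
  apply: ler_wpM2l; first by rewrite invr_ge0 mulr_ge0// ltW.
  rewrite lerD2l ler_pM2l ?invr_gt0//.
  apply: (@le_trans _ _ (p n * V n)); last by rewrite ler_pM2l.
  by move: x xo; near: n.
rewrite le_eqVlt; apply/orP; left; apply/eqP.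
by field; rewrite !gt_eqF.
Unshelve. all: by end_near. Qed.

Lemma whp_row_defect (row : forall n, graph n.+2 -> 'I_n.+2 -> R) :
  np n @[n --> \oo] --> +oo ->
  (forall d, 0 < d -> whp (fun n G => \sum_(x | other (a n) (b n) x)
        `|row n G x - (adj G (a n) x)%:R / np n| <= d)) ->
  forall d, 0 < d -> whp (fun n G => row_defect G (a n) (b n) (row n G) (np n) <= d).
Proof.
move=> hnp h d d0; have d3 : 0 < d / 4 by rewrite divr_gt0.
apply: whp_sub (whp_and (h _ d3) (whp_and (whp_out_deg d3 hnp) (whp_inv_deg d3 hnp))).
apply: nearW => n G _ /andP[h1 /andP[h2 h3]].
by rewrite /row_defect; move: h1 h2 h3; move: ((out_deg _ _ _).+1%:R^-1) => w h1 h2 h3; lra.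
Qed.

End Asymptotics.

(** The conditioning event is symmetric; this carries estimates on the rows at b, that is, on the
    columns, back to the pair a, b. *)
Lemma whpC (R : realType) (p : nat -> R) (a b : forall n, 'I_n.+2) P :
  whp p a b P -> whp p b a P.
Proof.
rewrite /whp => h.
rewrite (_ : (fun n => _) = fun n => cond_prob (p n) (a n) (b n) (fun G => ~~ P n G))//.
apply/funext => n; rewrite /cond_prob.
by congr (_ / _); apply: eq_bigl => G; rewrite adj_sym.
Qed.

(** * The marginals of both plans are nearly uniform *)

Section RowDefects.
Variables (R : realType) (p : nat -> R) (a b : forall n, 'I_n.+2).
Hypotheses (hab : forall n, a n != b n) (hp : forall n, 0 < p n <= 1).

Local Notation np n := (n%:R * p n).

Let p_gt0 n : 0 < p n. Proof. by case/andP: (hp n). Qed.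
Let np_ge0 n : 0 <= np n. Proof. by rewrite mulr_ge0// ltW. Qed.

Lemma cvgn_natr : (n%:R : R) @[n --> \oo] --> +oo.
Proof. exact: cvgr_idn. Qed.

(** The mass per path is 1/(np) divided by n^2 p^3, since a vertex x of A has about n^2 p^3 paths
    and should send out 1/(np). *)
Lemma whp_row4 : np n @[n --> \oo] --> +oo ->
  n%:R ^+ 2 * p n ^+ 3 @[n --> \oo] --> +oo ->
  forall d : R, 0 < d -> whp p a b (fun n G =>
    row_defect G (a n) (b n) (row4 G (np n * (n%:R ^+ 2 * p n ^+ 3))^-1 (a n) (b n)) (np n) <= d).
Proof.
move=> hnp h3; apply: whp_row_defect => // d d0.
apply: (whp_row_sum hab hp (U := fun n G x => ext4 R G (a n) (b n) x / (n%:R ^+ 2 * p n ^+ 3))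
  (V := fun n => 3 / np n + 1 / (n%:R ^+ 2 * p n ^+ 3) + 6 / n%:R)) => //.
- move=> n G x _; rewrite (_ : row4 _ _ _ _ _ - _ = (adj G (a n) x)%:R *
    (ext4 R G (a n) (b n) x / (n%:R ^+ 2 * p n ^+ 3) - 1) / np n).
    by rewrite 2!normrM ger0_norm// (ger0_norm (x := (np n)^-1)) ?invr_ge0.
  by rewrite /row4 invfM; ring.
- near=> n => x xo; apply: var_ext4 => //; rewrite ltr0n; near: n; exact: nbhs_infty_gt.
- apply: cvg0D; first apply: cvg0D.
  + exact: cvgy_div0.
  + exact: cvgy_div0.
  + by apply: cvgy_div0 => //; exact: cvgn_natr.
Unshelve. all: by end_near. Qed.

Lemma whp_row3 : np n @[n --> \oo] --> +oo -> (\forall n \near \oo, p n < 1) ->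
  n%:R * (p n ^+ 2 * (1 - p n)) @[n --> \oo] --> +oo ->
  forall d : R, 0 < d -> whp p a b (fun n G => row_defect G (a n) (b n)
    (row3 G (np n * (n%:R * (p n ^+ 2 * (1 - p n))))^-1 (np n) (a n) (b n)) (np n) <= d).
Proof.
move=> hnp hp1 hm; apply: whp_row_defect => // d d0.
apply: (whp_row_sum hab hp
  (U := fun n G x => excl_ext3 R G (a n) (b n) x / (n%:R * (p n ^+ 2 * (1 - p n))))
  (V := fun n => 2 / (n%:R * (p n ^+ 2 * (1 - p n))))) => //.
- move=> n G x _; rewrite /row3 (invfM (np n)).
  case: (adj G (a n) x); last by rewrite /= !(mul0r, mulr0, add0r, oppr0, normr0).
  (* A common neighbour keeps exactly 1/(np), so its error is 0. *)
  case: (adj G x (b n)) => /=.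
    by rewrite !(mul1r, mulr1, subrr, mulr0, mul0r, addr0, normr0) divr_ge0.
  rewrite !(mul1r, mulr1, mulr0, mul0r, add0r) subr0.
  rewrite (_ : _ - _ = (excl_ext3 R G (a n) (b n) x / (n%:R * (p n ^+ 2 * (1 - p n))) - 1)
    / np n); last by ring.
  by rewrite normrM (ger0_norm (x := (np n)^-1)) ?invr_ge0.
- near=> n => x xo; apply: var_excl_ext3 => //; first by near: n.
  by rewrite ltr0n; near: n; exact: nbhs_infty_gt.
- exact: cvgy_div0.
Unshelve. all: by end_near. Qed.

End RowDefects.

(** * Regimes (a) and (c) to (f) *)

Section Regimes.
Variables (R : realType) (p : nat -> R) (a b : forall n, 'I_n.+2).
Hypotheses (hab : forall n, a n != b n) (hp : forall n, 0 < p n <= 1).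

Local Notation np n := (n%:R * p n).
Local Notation kappa := (fun n (G : graph n.+2) => ricci (R := R) G (a n) (b n)).

Let hba n : b n != a n. Proof. by rewrite eq_sym. Qed.
Let p_gt0 n : 0 < p n. Proof. by case/andP: (hp n). Qed.
Let p_ge0 n : 0 <= p n. Proof. exact: ltW. Qed.
Let p_le1 n : p n <= 1. Proof. by case/andP: (hp n). Qed.
Let np_ge0 n : 0 <= np n. Proof. by rewrite mulr_ge0. Qed.

Lemma isolated_edgeP n (G : graph n.+2) : adj G (a n) (b n) ->
  isolated_edge G (a n) (b n) =
  (out_deg G (a n) (b n) == 0)%N && (out_deg G (b n) (a n) == 0)%N.
Proof.
move=> Gab; have Gba : adj G (b n) (a n) by rewrite adj_sym.
have one u v : adj G u v -> (nbhd G u == [set v]%SET) = (out_deg G u v == 0)%N.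
  move=> uv; have vu : v \in nbhd G u by rewrite inE.
  have := degE uv; rewrite /deg => dE; apply/eqP/eqP => [h|h].
    by move: dE; rewrite h cards1 => -[].
  by apply/esym/eqP; rewrite eqEcard finset.sub1set vu cards1 dE h.
by rewrite /isolated_edge !one.
Qed.

Lemma isolated_ricci n (G : graph n.+2) : adj G (a n) (b n) ->
  isolated_edge G (a n) (b n) -> kappa n G = 0.
Proof.
by move=> Gab; rewrite isolated_edgeP// => /andP[h _]; apply: ricci_leaf; rewrite ?h.
Qed.

Lemma whp_isolated : np n @[n --> \oo] --> (0 : R) ->
  whp p a b (fun n G => isolated_edge G (a n) (b n)).
Proof.
move=> h.
have h2 : 0 < (2^-1 : R) by [].
have z (m : nat) : (m%:R : R) <= 2^-1 -> m = 0%N.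
  case: m => // m hm; have : 1 <= 2^-1 :> R by apply: le_trans hm; rewrite -[leLHS]/(1%:R) ler_nat.
  by move=> ?; exfalso; lra.
have hA : whp p a b (fun n G => ((out_deg G (a n) (b n))%:R : R) <= 2^-1).
  by apply: (whp_markov hab hp h2 _ _ h) => //; apply: nearW => n; rewrite E_out_deg.
have hB : whp p b a (fun n G => ((out_deg G (b n) (a n))%:R : R) <= 2^-1).
  by apply: (whp_markov hba hp h2 _ _ h) => //; apply: nearW => n; rewrite E_out_deg.
apply: (whp_sub hab hp _ (whp_and hab hp hA (whpC hB))).
by apply: nearW => n G Gab /= /andP[/z hA' /z hB']; rewrite isolated_edgeP// hA' hB'.
Qed.

Lemma ricci_regime_c : np n @[n --> \oo] --> +oo ->
  n%:R ^+ 2 * p n ^+ 3 @[n --> \oo] --> (0 : R) -> conv_in_prob p a b kappa (-2).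
Proof.
move=> hnp h3.
(* Once np >= 1, n p^2 is at most n p^2 times np, which is n^2 p^3. *)
have h2 : n%:R * p n ^+ 2 @[n --> \oo] --> (0 : R).
  apply: cvg0_squeeze h3; near=> n; rewrite mulr_ge0 ?exprn_ge0//=.
  have h1 : 1 <= np n by near: n; move/cvgryPge : hnp; exact.
  have -> : n%:R ^+ 2 * p n ^+ 3 = n%:R * p n ^+ 2 * np n by ring.
  by rewrite ler_peMr// mulr_ge0// exprn_ge0.
(* The lower bound on W1 loses 2/da + 3 [paths4]/da + 2/db, with coefficients adding up to 7. *)
apply: whp_conv_in_prob => e e0; have d0 : 0 < e / 7 by rewrite divr_gt0.
have hC5 : whp p a b (fun n G => paths4 R G (a n) (b n) / (out_deg G (a n) (b n)).+1%:R <= e / 7).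
  apply: whp_over_deg => // [n G|d dd0]; first exact: paths4_ge0.
  apply: (whp_markov hab hp dd0 _ _ h3).
    by move=> n G _; rewrite divr_ge0// paths4_ge0.
  near=> n.
  have n2 : 2 <= n%:R :> R by rewrite ler_nat; near: n; exact: nbhs_infty_ge.
  under eq_cond_exp do rewrite mulrC.
  have np0 : 0 < np n by rewrite mulr_gt0// (lt_le_trans _ n2).
  rewrite cond_expZ ler_pdivrMl//; apply: le_trans (E_paths4 (hp n) (hab n) n2) _.
  by rewrite le_eqVlt; apply/orP; left; apply/eqP; ring.
have hdB := whpC (whp_inv_deg hba hp d0 hnp).
apply: (whp_sub hab hp _ (whp_and hab hp (whp_paths2 hab hp h2) (whp_and hab hp
   (whp_paths3 hab hp h3) (whp_and hab hp hC5 (whp_and hab hp (whp_inv_deg hab hp d0 hnp) hdB))))).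
near=> n => G Gab /= /and5P[/eqP z2 /eqP z3 hc5 hda hdb].
have n1 : (2 < n.+2)%N by rewrite !ltnS; near: n; exact: nbhs_infty_gt.
have lo := W1_ge_paths4 Gab n1 z2 z3; have up := W1_nbhd_le3 R Gab.
rewrite /ricci; set W := W1 _ _ _ in lo up *.
rewrite ger0_norm; last lra.
move: lo hc5 hda hdb; set da : R := (out_deg G (a n) (b n)).+1%:R.
have -> : (out_deg G (a n) (b n))%:R = da - 1 by rewrite /da -natr1 addrK.
have da0 : da != 0 by rewrite pnatr_eq0.
set C := paths4 _ _ _ _.
have -> : (3 * (da - 1 - C) + 1) / da = 3 - 2 * da^-1 - 3 * (C / da) by field.
move: (C / da) da^-1 ((out_deg _ _ _).+1%:R^-1) => u v w lo hu hv hw.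
lra.
Unshelve. all: by end_near. Qed.

Lemma ricci_regime_d : n%:R ^+ 2 * p n ^+ 3 @[n --> \oo] --> +oo ->
  n%:R * p n ^+ 2 @[n --> \oo] --> (0 : R) -> conv_in_prob p a b kappa (-1).
Proof.
move=> h3 h2.
(* Here np is at least n^2 p^3 as soon as n p^2 <= 1. *)
have hnp : np n @[n --> \oo] --> +oo.
  apply/cvgryPge => A; near=> n.
  have hA : A <= n%:R ^+ 2 * p n ^+ 3 by near: n; move/cvgryPge : h3; exact.
  have h1 : n%:R * p n ^+ 2 <= 1.
    by apply: le_trans (ler_norm _) _; near: n; apply: cvgr0_norm_le.
  apply: le_trans hA _.
  have -> : n%:R ^+ 2 * p n ^+ 3 = np n * (n%:R * p n ^+ 2) by ring.
  by rewrite ler_piMr.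
(* The upper bound on W1 has error 5 (r1 + r2), hence 10; the lower bound only loses 5 times
   e/10. *)
apply: whp_conv_in_prob => e e0; have d0 : 0 < e / 10 by rewrite divr_gt0.
have hC4 : whp p a b (fun n G => paths3 R G (a n) (b n) / (out_deg G (a n) (b n)).+1%:R <= e / 10).
  apply: whp_over_deg => // [n G|d dd0]; first exact: paths3_ge0.
  apply: (whp_markov hab hp dd0 _ _ h2).
    by move=> n G _; rewrite divr_ge0// paths3_ge0.
  near=> n.
  have n0 : 0 < n%:R :> R by rewrite ltr0n; near: n; exact: nbhs_infty_gt.
  under eq_cond_exp do rewrite mulrC.
  have np0 : 0 < np n by rewrite mulr_gt0.
  rewrite cond_expZ ler_pdivrMl//; apply: le_trans (E_paths3 (hp n) (hab n) n0) _.
  by rewrite le_eqVlt; apply/orP; left; apply/eqP; ring.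
have hdB := whpC (whp_inv_deg hba hp d0 hnp).
have hrB := whpC (whp_row4 hba hp hnp h3 d0).
apply: (whp_sub hab hp _ (whp_and hab hp (whp_and hab hp (whp_paths2 hab hp h2) hC4)
   (whp_and hab hp (whp_inv_deg hab hp d0 hnp) (whp_and hab hp hdB
   (whp_and hab hp (whp_row4 hab hp hnp h3 d0) hrB))))).
near=> n => G Gab /= /and5P[/andP[/eqP z2 hc4] hda hdb hra hrb].
have n0 : 0 < n%:R :> R by rewrite ltr0n; near: n; exact: nbhs_infty_gt.
have np0 : 0 < np n by rewrite mulr_gt0.
have lo := W1_ge_paths3 Gab isT z2.
have c0 : 0 <= (np n * (n%:R ^+ 2 * p n ^+ 3))^-1 by rewrite invr_ge0 !mulr_ge0 ?exprn_ge0.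
have up := W1_le_row4 Gab c0 np0.
rewrite /ricci; set W := W1 _ _ _ in lo up *.
move: lo hc4 hda hdb; set da : R := (out_deg G (a n) (b n)).+1%:R.
have -> : (out_deg G (a n) (b n))%:R = da - 1 by rewrite /da -natr1 addrK.
have da0 : da != 0 by rewrite pnatr_eq0.
set C := paths3 _ _ _ _.
have -> : 2 * (da - 1 - C) / da = 2 - 2 * da^-1 - 2 * (C / da) by field.
move: up hra hrb; set r1 := row_defect _ _ _ _ _; set r2 := row_defect _ _ _ _ _.
move: (C / da) da^-1 ((out_deg _ _ _).+1%:R^-1) => u v w up hra hrb lo hu hv hw.
by rewrite ler_norml; apply/andP; split; lra.
Unshelve. all: by end_near. Qed.

(** The bounds are W1 >= 1 - [paths2]/da and W1 <= 1 - [paths2]/(np) up to the defects, and both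
    quotients are close to p. The value q = 0 gives (e), q > 0 gives (f). *)
Lemma ricci_regime_ef (q : R) : 0 <= q < 1 -> n%:R * p n ^+ 2 @[n --> \oo] --> +oo ->
  p n @[n --> \oo] --> q -> conv_in_prob p a b kappa q.
Proof.
move=> /andP[q0 q1] h2 hq.
have hnp : np n @[n --> \oo] --> +oo.
  apply/cvgryPge => A; near=> n.
  have hA : A <= n%:R * p n ^+ 2 by near: n; move/cvgryPge : h2; exact.
  by apply: le_trans hA _; rewrite ler_wpM2l// expr2 ler_piMr.
(* A bound on p away from 1, so that the factor 1 - p does not spoil the divergence of n p^2 (1 -
   p). *)
have hp1 : \forall n \near \oo, p n <= (1 + q) / 2.
  have q' : q < (1 + q) / 2 by lra.
  by near=> n; apply: ltW; near: n; exact: cvgr_lt hq _ q'.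
have hlt1 : \forall n \near \oo, p n < 1.
  by near=> n; apply: (@le_lt_trans _ _ ((1 + q) / 2)); [near: n|lra].
have hm : n%:R * (p n ^+ 2 * (1 - p n)) @[n --> \oo] --> +oo.
  apply/cvgryPge => A; near=> n.
  have hA : A / ((1 - q) / 2) <= n%:R * p n ^+ 2 by near: n; move/cvgryPge : h2; exact.
  have hpn : p n <= (1 + q) / 2 by near: n.
  rewrite ler_pdivrMr in hA; last by rewrite divr_gt0// subr_gt0.
  apply: le_trans hA _; rewrite -mulrA; apply: ler_wpM2l => //.
  by apply: ler_wpM2l; [rewrite exprn_ge0|lra].
apply: whp_conv_in_prob => e e0.
have [d [d0 dl de]] : exists d : R, [/\ 0 < d, d <= 2^-1 & d <= e / 20].
  exists (Num.min 2^-1 (e / 20)); rewrite !ge_min !lexx orbT; split=> //.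
  by rewrite lt_min divr_gt0// invr_gt0 ltr0n.
have dd0 : 0 < d ^+ 2 by exact: exprn_gt0.
have hC3 : whp p a b (fun n G => `|paths2 R G (a n) (b n) / (n%:R * p n ^+ 2) - 1| <= d).
  apply: (whp_sub hab hp _ (whp_markov hab hp
    (f := fun n G => (paths2 R G (a n) (b n) / (n%:R * p n ^+ 2) - 1) ^+ 2)
    dd0 _ _ (cvgy_div0 (ler0n R 2) h2))).
  - apply: nearW => n G _ /=.
    by rewrite -[X in X <= _ -> _]real_normK ?num_real// ler_pXn2r// nnegrE ltW.
  - by move=> n G _; exact: sqr_ge0.
  - by near=> n; apply: var_paths2 => //; rewrite ltr0n; near: n; exact: nbhs_infty_gt.
have hrB := whpC (whp_row3 hba hp hnp hlt1 hm d0).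
apply: (whp_sub hab hp _ (whp_and hab hp hC3 (whp_and hab hp (whp_out_deg hab hp d0 hnp)
   (whp_and hab hp (whp_row3 hab hp hnp hlt1 hm d0) hrB)))).
near=> n => G Gab /= /and4P[hc3 hda hra hrb].
have n0 : 0 < n%:R :> R by rewrite ltr0n; near: n; exact: nbhs_infty_gt.
have np0 : 0 < np n by rewrite mulr_gt0.
have pq : `|p n - q| <= d.
  by near: n; apply: cvgr_distC_le; [exact: hq|exact: d0].
have pn1 : p n < 1 by near: n.
have lo := W1_ge_paths2 R Gab.
have c0 : 0 <= (np n * (n%:R * (p n ^+ 2 * (1 - p n))))^-1.
  by rewrite invr_ge0 !mulr_ge0 ?exprn_ge0// subr_ge0.
have up := W1_le_row3 Gab c0 np0.
rewrite /ricci; set W := W1 _ _ _ in lo up *.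
move: lo up hc3 hda; set da : R := (out_deg G (a n) (b n)).+1%:R; set C := paths2 _ _ _ _.
set A : R := (out_deg G (a n) (b n))%:R.
have daA : A <= da by rewrite ler_nat.
have da0 : 0 < da by rewrite ltr0n.
set r1 := row_defect _ _ _ _ _ in hra *; set r2 := row_defect _ _ _ _ _ in hrb *.
have CE : C / np n = p n * (C / (n%:R * p n ^+ 2)) by field; rewrite !gt_eqF.
set t := C / (_ * _ ^+ 2) in CE *.
move=> lo up; rewrite !ler_norml => /andP[t1 t2] /andP[A1 _].
have C0 : 0 <= C by apply: sumr_ge0.
have Cda : C / da <= p n * (1 + 4 * d).
  have h1 : (1 - d) * np n <= da.
    by apply: le_trans daA; rewrite -ler_pdivlMr//; lra.
  rewrite ler_pdivrMr//.
  have -> : C = p n * t * np n by rewrite -CE divfK// gt_eqF.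
  apply: (@le_trans _ _ (p n * (1 + 4 * d) * ((1 - d) * np n))); last first.
    by rewrite ler_pM2l// mulr_gt0//; lra.
  have -> : p n * (1 + 4 * d) * ((1 - d) * np n) = p n * ((1 + 4 * d) * (1 - d)) * np n by ring.
  rewrite ler_pM2r// ler_pM2l//.
  (* This gives 1 + d <= (1 + 4d)(1 - d), the difference being 4d(1/2 - d); it is the reason for
     choosing d <= 1/2. *)
  have : 0 <= d * (2^-1 - d) by rewrite mulr_ge0 ?subr_ge0// ltW.
  lra.
have p4d : p n * (1 + 4 * d) <= p n + 4 * d.
  have : p n * (4 * d) <= 4 * d by rewrite ler_piMl// mulr_ge0// ltW.
  lra.
have ptd : p n - d <= p n * t.
  have : p n * (1 - d) <= p n * t by rewrite ler_pM2l//; lra.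
  have : p n * d <= d by rewrite ler_piMl// ltW.
  lra.
move: pq; rewrite ler_norml => /andP[pq1 pq2].
rewrite CE in up.
move: lo up Cda ptd p4d hra hrb.
move: (C / da) (p n * t) (p n * (1 + 4 * d)) r1 r2 W => v1 v2 v3 v4 v5 w *.
by apply/andP; split; lra.
Unshelve. all: by end_near. Qed.

End Regimes.

(** * Joint law of the two degrees *)

Definition binom_pmf (R : realType) (n : nat) (p : R) (k : nat) : R :=
  'C(n, k)%:R * p ^+ k * (1 - p) ^+ (n - k).

Section DegreeLaw.
Variables (n : nat) (R : realType) (p : R) (a b : 'I_n.+2).
Hypotheses (p01 : 0 < p <= 1) (ab : a != b).
Implicit Types (G : graph n.+2) (x : 'I_n.+2) (S : {set 'I_n.+2}).

Let D : {set 'I_n.+2} := [set x | other a b x]%SET.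
Let cardD : #|D| = n.
Proof. by rewrite /D cardsE (card_other ab). Qed.

Let NA G : {set 'I_n.+2} := [set x in D | adj G a x]%SET.
Let NB G : {set 'I_n.+2} := [set x in D | adj G b x]%SET.

(** The edges from a and from b to the other vertices are distinct from each other and from a-b, so
    prescribing both neighbourhoods is one list of independent literals. *)
Lemma cond_exp_nbhds S1 S2 : S1 \subset D -> S2 \subset D ->
  cond_exp p a b (fun G => ((NA G == S1) && (NB G == S2))%:R) =
  p ^+ #|S1| * (1 - p) ^+ (n - #|S1|) * (p ^+ #|S2| * (1 - p) ^+ (n - #|S2|)).
Proof.
move=> S1D S2D.
have inD x : x \in enum D -> (x != a) && (x != b) by rewrite mem_enum inE.
have neqD u v : (u == a) && (v == b) || (u == b) && (v == a) -> forall S,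
    pairwise (fun l l' : lit n.+2 => ~~ same_pair l.1 l'.1)
      [seq (u, x, x \in S) | x <- enum D].
  move=> uv S; rewrite pairwise_map; have := enum_uniq D; rewrite uniq_pairwise.
  apply: sub_in_pairwise => // x y xD yD /= xy; rewrite /same_pair /= eqxx /= (negPf xy) /=.
  have /andP[xa xb] := inD _ xD; have /andP[ya yb] := inD _ yD.
  by case/orP: uv => /andP[/eqP -> _]; rewrite eq_sym ?(negPf ya) ?(negPf yb).
have wS S : S \subset D -> \prod_(x in D) lit_weight p (x \in S) =
    p ^+ #|S| * (1 - p) ^+ (n - #|S|).
  move=> SD; rewrite (bigID (mem S)) /=; congr (_ * _).
    rewrite (eq_bigl (mem S)); last first.
      by move=> x /=; apply/andb_idl/(fintype.subsetP SD).
    by rewrite (eq_bigr (fun=> p)) ?prodr_const// => x /= ->.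
  rewrite (eq_bigr (fun=> 1 - p)); last by move=> x /andP[_ /negPf ->].
  rewrite (eq_bigl (mem (D :\: S)%SET)); last by move=> x /=; rewrite finset.in_setD andbC.
  by rewrite prodr_const cardsD (finset.setIidPr SD) cardD.
have nbE u S G : S \subset D ->
    ([set x in D | adj G u x]%SET == S) = all (fun x => holds G (u, x, x \in S)) (enum D).
  move=> SD; apply/eqP/allP => [<- x|h].
    by rewrite mem_enum => xD; rewrite /holds /= finset.in_set xD.
  apply/setP => x; rewrite finset.in_set; have [xD|xD] := boolP (x \in D).
    by have := h x; rewrite mem_enum => /(_ xD)/eqP.
  by rewrite (contraNF (fintype.subsetP SD x) xD).
rewrite (cond_exp_bool p01 ab (s := [seq (a, x, x \in S1) | x <- enum D] ++
   [seq (b, x, x \in S2) | x <- enum D])).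
- by rewrite big_cat !big_map /= !big_enum /= !wS.
- rewrite /indep_lits /= ab /=; apply/and3P; split.
  + rewrite all_cat !all_map; apply/andP; split; apply/allP => x /inD/andP[xa xb] /=;
    by rewrite eq_sym.
  + rewrite all_cat !all_map; apply/andP; split; apply/allP => x /inD/andP[xa xb] /=;
    by rewrite /same_pair /= ?eqxx ?(negPf ab) !(eq_sym _ x) (negPf xa) (negPf xb) ?andbF.
  + rewrite pairwise_cat; apply/and3P; split; last 2 first.
    * by apply: (neqD a b); rewrite !eqxx.
    * by apply: (neqD b a); rewrite !eqxx orbT.
    apply/allrelP => l l' /mapP[x /inD/andP[xa xb] ->] /mapP[y /inD/andP[ya yb] ->].
    by rewrite /same_pair /= (negPf ab) /= !(eq_sym _ y) (negPf ya).
- by move=> G; rewrite all_cat !all_map !nbE.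
Qed.

(** Sum over the neighbourhoods of sizes k and l, whose numbers are the binomial coefficients.
    Independence is exact for every n, because the shared edge is not counted. *)
Lemma degree_law k l :
  cond_prob p a b (fun G => (out_deg G a b == k) && (out_deg G b a == l)) =
  binom_pmf n p k * binom_pmf n p l.
Proof.
rewrite (cond_probE p a b).
pose Q k S := (S \subset D) && (#|S| == k).
have cardNA G : out_deg G a b = #|NA G|.
  by rewrite /out_deg -cardsE; apply: eq_card => x; rewrite !inE.
have cardNB G : out_deg G b a = #|NB G|.
  by rewrite /out_deg -cardsE; apply: eq_card => x; rewrite !inE otherC.
have sel (T : {set 'I_n.+2}) m : T \subset D -> \sum_(S | Q m S) (T == S)%:R = (#|T| == m)%:R :> R.
  move=> TD; have [Tm|Tm] := eqVneq #|T| m.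
    rewrite (bigD1 T) /=; last by rewrite /Q TD Tm eqxx.
    by rewrite eqxx big1 ?addr0// => S /andP[_ /negPf]; rewrite eq_sym => ->.
  apply: big1 => S /andP[_ /eqP Sm]; case: eqVneq => // TS.
  by move: Tm; rewrite TS Sm eqxx.
have NAD G : NA G \subset D by apply/fintype.subsetP => x; rewrite finset.in_set => /andP[].
have NBD G : NB G \subset D by apply/fintype.subsetP => x; rewrite finset.in_set => /andP[].
rewrite (@eq_cond_exp _ _ _ _ _ _ (fun G => \sum_(S1 | Q k S1) \sum_(S2 | Q l S2)
   ((NA G == S1) && (NB G == S2))%:R)); last first.
  move=> G _; rewrite cardNA cardNB -mulnb natrM -(sel _ k (NAD G)) -(sel _ l (NBD G)).
  rewrite big_distrl; apply: eq_bigr => S1 _ /=; rewrite big_distrr; apply: eq_bigr => S2 _ /=.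
  by rewrite -natrM mulnb.
rewrite cond_exp_sum; under eq_bigr do rewrite cond_exp_sum.
rewrite (eq_bigr (fun=> \sum_(S2 | Q l S2)
    p ^+ k * (1 - p) ^+ (n - k) * (p ^+ l * (1 - p) ^+ (n - l)))); last first.
  move=> S1 /andP[S1D /eqP S1k]; apply: eq_bigr => S2 /andP[S2D /eqP S2l].
  by rewrite cond_exp_nbhds// S1k S2l.
have cQ m (c : R) : \sum_(S | Q m S) c = 'C(n, m)%:R * c.
  rewrite big_const iter_addr_0 mulr_natl; congr (_ *+ _).
  have -> : 'C(n, m) = 'C(#|D|, m) by rewrite cardD.
  by rewrite -cards_draws; apply: eq_card => S; rewrite finset.in_set.
by rewrite !cQ /binom_pmf; ring.
Qed.

End DegreeLaw.

(** * Poisson limit of the binomial law *)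

Section PoissonLimit.
Variables (R : realType) (p : nat -> R) (lambda : R).
Hypotheses (hp : forall n, 0 < p n <= 1) (lambda0 : 0 < lambda).
Hypotheses (hnp : n%:R * p n @[n --> \oo] --> lambda) (p_to0 : p n @[n --> \oo] --> (0 : R)).

Let sub_cvg k : (n - k)%:R * p n @[n --> \oo] --> lambda.
Proof.
have h : n%:R * p n - k%:R * p n @[n --> \oo] --> lambda.
  rewrite -[lambda]subr0; apply: cvgB hnp _; rewrite -(mulr0 (k%:R)).
  by apply: cvgM p_to0; exact: cvg_cst.
apply: cvg_trans h; apply: near_eq_cvg; near=> n.
by rewrite natrB ?mulrBl//; near: n; exact: nbhs_infty_ge.
Unshelve. all: by end_near. Qed.

Lemma bin_pow_cvg k : 'C(n, k)%:R * p n ^+ k @[n --> \oo] --> lambda ^+ k / k`!%:R.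
Proof.
elim: k => [|k IH].
  rewrite (_ : (fun n => _) = fun=> 1); last by apply/funext => n; rewrite bin0 expr0 mul1r.
  by rewrite expr0 fact0 divr1; exact: cvg_cst.
have -> : lambda ^+ k.+1 / k.+1`!%:R = lambda ^+ k / k`!%:R * (lambda / k.+1%:R).
  by rewrite factS natrM exprSr invfM; ring.
rewrite (_ : (fun n => _) = fun n => 'C(n, k)%:R * p n ^+ k * ((n - k)%:R * p n / k.+1%:R)).
  by apply: cvgM IH _; apply: cvgM (sub_cvg k) _; exact: cvg_cst.
apply/funext => n; have := mul_bin_left n k => /(congr1 (fun m => m%:R : R)).
rewrite !natrM => h; have k0 : k.+1%:R != 0 :> R by rewrite pnatr_eq0.
have -> : 'C(n, k.+1)%:R = (n - k)%:R * 'C(n, k)%:R / k.+1%:R :> R.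
  by rewrite -h mulrC mulKf.
by rewrite exprSr; ring.
Qed.

(** Squeeze by the powers of exp(-p/(1 - p)) <= 1 - p <= exp(-p); both exponents, times n - k, tend
    to -lambda. *)
Lemma onem_pow_cvg k : (1 - p n) ^+ (n - k) @[n --> \oo] --> expR (- lambda).
Proof.
apply: (@squeeze_cvgr _ _ _ _ (fun n => expR (- ((n - k)%:R * p n / (1 - p n))))
   (fun n => expR (- ((n - k)%:R * p n)))); last 2 first.
- apply: (@cvg_comp _ _ _ (fun n => - ((n - k)%:R * p n / (1 - p n))) (@expR R)); last first.
    exact: continuous_expR.
  apply: cvgN; rewrite -[lambda]divr1 -[X in _ / X]subr0; apply: cvgM; first exact: sub_cvg.
  by apply: cvgV; rewrite ?subr0 ?oner_eq0// -{2}[1]subr0; apply: cvgB p_to0; exact: cvg_cst.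
- apply: (@cvg_comp _ _ _ (fun n => - ((n - k)%:R * p n)) (@expR R)); last exact: continuous_expR.
  by apply: cvgN; exact: sub_cvg.
near=> n.
have pn0 : 0 < p n by case/andP: (hp n).
have pn1 : p n < 1.
  by near: n; exact: cvgr_lt p_to0 _ ltr01.
have q0 : 0 < 1 - p n by rewrite subr_gt0.
have lo : expR (- (p n / (1 - p n))) <= 1 - p n.
  rewrite expRN invf_ple ?posrE ?expR_gt0//.
  by apply: le_trans (expR_ge1Dx _); rewrite -[leLHS]mul1r -[X in X / _](subrK (p n)) mulrDl divff ?gt_eqF.
have up : 1 - p n <= expR (- p n) by exact: expR_ge1Dx.
have -> : expR (- ((n - k)%:R * p n / (1 - p n))) = expR (- (p n / (1 - p n))) ^+ (n - k).
  by rewrite -expRM_natl -mulrA mulrN.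
have -> : expR (- ((n - k)%:R * p n)) = expR (- p n) ^+ (n - k).
  by rewrite -expRM_natl mulrN.
apply/andP; split.
  by apply: lerXn2r => //; rewrite nnegrE ?expR_ge0 ?(ltW q0).
by apply: lerXn2r => //; rewrite nnegrE ?expR_ge0 ?(ltW q0).
Unshelve. all: by end_near. Qed.

Lemma binom_pmf_cvg k : binom_pmf n (p n) k @[n --> \oo] --> poisson_pmf lambda k.
Proof.
rewrite /poisson_pmf lambda0 /binom_pmf.
by apply: cvgM; [exact: bin_pow_cvg|exact: onem_pow_cvg].
Qed.

End PoissonLimit.

(** * Infinite sums over pairs of degrees, truncated to finite boxes *)

Section Boxes.
Variables (R : realType) (S : pred (nat * nat)).
Implicit Types (f : nat * nat -> R) (g : nat -> R).

Definition box (K : nat) : seq (nat * nat) := [seq (k, l) | k <- iota 0 K, l <- iota 0 K].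

Lemma mem_box K v : (v \in box K) = (v.1 < K)%N && (v.2 < K)%N.
Proof.
case: v => k l /=; apply/allpairsP/andP => [[[k' l'] /= []]|[hk hl]].
  by rewrite !mem_iota /= => hk hl [-> ->].
by exists (k, l); rewrite !mem_iota.
Qed.

Lemma box_uniq K : uniq (box K).
Proof. by apply: allpairs_uniq; rewrite ?iota_uniq// => -[? ?] [? ?] _ _ [-> ->]. Qed.

Lemma sum_box_prod g K : \sum_(v <- box K) g v.1 * g v.2 = (\sum_(0 <= k < K) g k) ^+ 2.
Proof.
rewrite big_allpairs /= expr2 big_distrl /= /index_iota subn0; apply: eq_bigr => k _.
by rewrite big_distrr.
Qed.

Lemma sum_subseq_uniq (r L : seq (nat * nat)) (P : pred (nat * nat)) f :
  uniq r -> uniq L -> {subset r <= L} ->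
  \sum_(v <- r | P v) f v = \sum_(v <- L | P v && (v \in r)) f v.
Proof.
move=> ur uL rL; rewrite (perm_big [seq v <- L | v \in r]) /=.
  by rewrite big_filter_cond; apply: eq_bigl => v; rewrite andbC.
apply: uniq_perm => //; first exact: filter_uniq.
by move=> v; rewrite mem_filter; apply/esym/andb_idr/rL.
Qed.

Lemma box_mono K K' f : (forall v, 0 <= f v) -> (K <= K')%N ->
  \sum_(v <- box K' | S v) f v - \sum_(v <- box K | S v) f v <=
  \sum_(v <- box K') f v - \sum_(v <- box K) f v.
Proof.
move=> f0 KK'.
have sub : {subset box K <= box K'}.
  by move=> v; rewrite !mem_box => /andP[/leq_trans h1 /leq_trans h2]; rewrite h1 ?h2.
rewrite !(sum_subseq_uniq _ _ (box_uniq K) (box_uniq K') sub).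
rewrite (bigID (fun v => v \in box K) S) [\sum_(v <- box K') f v](bigID (fun v => v \in box K)) /=.
rewrite !(addrAC _ _ (- _)) !subrr !add0r.
by rewrite big_mkcond [leRHS]big_mkcond; apply: ler_sum => v _ /=; case: (S v) => //=; case: ifP.
Qed.

Lemma sum_box_ind K (v : nat * nat) :
  \sum_(u <- box K | S u) (v == u)%:R = ((v \in box K) && S v)%:R :> R.
Proof.
have [vK|vK] := boolP (v \in box K); last first.
  rewrite big_seq_cond big1// => u /andP[uK _]; case: eqVneq => // vu.
  by move: vK; rewrite vu uK.
rewrite big_mkcond (bigD1_seq v) ?box_uniq//= eqxx big1 ?addr0 => [|u /negPf].
  by case: (S v).
by rewrite eq_sym => ->; case: (S u).
Qed.

Lemma esum_box_ge f K : (forall v, 0 <= f v) ->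
  ((\sum_(v <- box K | S v) f v)%:E <= \esum_(v in [set v | S v]) (f v)%:E)%E.
Proof.
move=> f0; apply: esum_ge; exists [set` [seq v <- box K | S v]].
  by split; [exact: finite_seq|move=> v /=; rewrite mem_filter => /andP[]].
rewrite -fsbig_seq ?filter_uniq ?box_uniq//.
by rewrite sumEFin big_filter.
Qed.

(** Every finite part of S lies in a larger box, and what that box adds to [box K] weighs at most
    the total mass bound 1 minus the mass of [box K]. *)
Lemma esum_box_le f K : (forall v, 0 <= f v) ->
  (forall K', \sum_(v <- box K') f v <= 1) ->
  (\esum_(v in [set v | S v]) (f v)%:E <=
   (\sum_(v <- box K | S v) f v + (1 - \sum_(v <- box K) f v))%:E)%E.
Proof.
move=> f0 f1; apply: ge_ereal_sup => _ [A [fA AS] <-].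
rewrite fsbig_finite//= sumEFin lee_fin.
set r := enum_fset (fset_set A).
have rS v : v \in r -> S v.
  by move=> vr; have : v \in fset_set A by []; rewrite in_fset_set// inE => /AS.
(* The sum of all coordinates in [r], with a successor in each summand, strictly exceeds each single
   coordinate. *)
pose K' := (K + \sum_(v <- r) (v.1 + v.2).+1)%N.
have sub : {subset r <= box K'}.
  move=> v vA; rewrite mem_box /K' (big_rem v)//=.
  by apply/andP; split; lia.
apply: (@le_trans _ _ (\sum_(v <- box K' | S v) f v)).
  rewrite (sum_subseq_uniq predT _ (fset_uniq _) (box_uniq K') sub) /=.
  rewrite big_mkcond [leRHS]big_mkcond; apply: ler_sum => v _.
  by case: ifPn => [/rS ->|_] //; case: ifP.
have := box_mono f0 (leq_addr _ K : (K <= K')%N); have := f1 K'; lra.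
Qed.

End Boxes.

(** * Regime (b) *)

Section PoissonRegime.
Variables (R : realType) (p : nat -> R) (a b : forall n, 'I_n.+2) (lambda : R).
Hypotheses (hab : forall n, a n != b n) (hp : forall n, 0 < p n <= 1) (lambda0 : 0 < lambda).
Hypotheses (hnp : n%:R * p n @[n --> \oo] --> lambda) (p_to0 : p n @[n --> \oo] --> (0 : R)).

Let p_gt0 n : 0 < p n. Proof. by case/andP: (hp n). Qed.
Let p_ge0 n : 0 <= p n. Proof. exact: ltW. Qed.

Local Notation kappa := (fun n (G : graph n.+2) => ricci (R := R) G (a n) (b n)).
Local Notation oA n G := (out_deg G (a n) (b n)).
Local Notation oB n G := (out_deg G (b n) (a n)).

Let poi2 (v : nat * nat) : R := poisson_pmf lambda v.1 * poisson_pmf lambda v.2.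

Let poi2_ge0 v : 0 <= poi2 v.
Proof. by rewrite mulr_ge0// poisson_pmf_ge0. Qed.

Lemma sum_poisson_cvg : \sum_(0 <= k < K) poisson_pmf lambda k @[K --> \oo] --> (1 : R).
Proof.
have -> : (fun K => \sum_(0 <= k < K) poisson_pmf lambda k) =
    fun K => series (exp_coeff lambda) K * expR (- lambda).
  apply/funext => K; rewrite /series /= big_distrl /=; apply: eq_bigr => k _.
  by rewrite /poisson_pmf lambda0.
rewrite -(expRxMexpNx_1 lambda); apply: cvgM; last exact: cvg_cst.
exact: is_cvg_series_exp_coeff.
Qed.

Lemma sum_poisson_le1 K : \sum_(0 <= k < K) poisson_pmf lambda k <= 1.
Proof.
have h := sum_poisson_cvg; rewrite -(cvg_lim (@Rhausdorff R) h).
apply: (nondecreasing_cvgn_le (u_ := fun K => \sum_(0 <= k < K) poisson_pmf lambda k)).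
  apply/nondecreasing_seqP => m; rewrite big_nat_recr//= lerDl; exact: poisson_pmf_ge0.
by apply/cvg_ex; exists 1.
Qed.

Lemma box_poisson_le1 K : \sum_(v <- box K) poi2 v <= 1.
Proof.
rewrite /poi2 sum_box_prod expr_le1// ?sum_poisson_le1//.
by apply: sumr_ge0 => k _; exact: poisson_pmf_ge0.
Qed.

Lemma box_poisson_cvg : \sum_(v <- box K) poi2 v @[K --> \oo] --> (1 : R).
Proof.
under eq_fun do rewrite /poi2 sum_box_prod expr2.
by rewrite -[1]mulr1; apply: cvgM; exact: sum_poisson_cvg.
Qed.

Lemma cond_prob_box n (S : pred (nat * nat)) K :
  cond_prob (p n) (a n) (b n) (fun G => ((oA n G, oB n G) \in box K) && S (oA n G, oB n G)) =
  \sum_(v <- box K | S v) binom_pmf n (p n) v.1 * binom_pmf n (p n) v.2.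
Proof.
rewrite cond_probE.
rewrite (@eq_cond_exp _ _ _ _ _ _
  (fun G => \sum_(v <- box K | S v) ((oA n G, oB n G) == v)%:R)); last first.
  by move=> G _; rewrite sum_box_ind.
rewrite cond_exp_sum; apply: eq_bigr => -[k l] _ /=.
by rewrite -cond_probE -(degree_law (hp n) (hab n)).
Qed.

Lemma cond_prob_box_cvg (S : pred (nat * nat)) K :
  cond_prob (p n) (a n) (b n) (fun G => ((oA n G, oB n G) \in box K) && S (oA n G, oB n G))
    @[n --> \oo] --> \sum_(v <- box K | S v) poi2 v.
Proof.
rewrite (_ : (fun n => _) = fun n =>
  \sum_(v <- box K | S v) binom_pmf n (p n) v.1 * binom_pmf n (p n) v.2); last first.
  by apply/funext => n; rewrite cond_prob_box.
elim: (box K) => [|v r IH].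
  rewrite big_nil (_ : (fun n => _) = fun=> 0); first exact: cvg_cst.
  by apply/funext => n; rewrite big_nil.
rewrite big_cons (_ : (fun n => _) = fun n =>
   let t := \sum_(v <- r | S v) binom_pmf n (p n) v.1 * binom_pmf n (p n) v.2 in
   if S v then binom_pmf n (p n) v.1 * binom_pmf n (p n) v.2 + t else t); last first.
  by apply/funext => n; rewrite big_cons.
by case: (S v) => //; apply: cvgD IH; apply: cvgM; exact: binom_pmf_cvg.
Qed.

(** Pointwise convergence of the joint law extends to any set S because no mass escapes: the limit
    has total mass 1, so some finite box carries all but e/4 of it, and nearly as much of the law
    for large n. *)
Lemma degrees_cvg (S : pred (nat * nat)) :
  cond_prob (p n) (a n) (b n) (fun G => S (oA n G, oB n G)) @[n --> \oo] -->
  fine (\esum_(v in [set v | S v]) (poi2 v)%:E).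
Proof.
set F := fine _.
have FK K : \sum_(v <- box K | S v) poi2 v <= F <=
    \sum_(v <- box K | S v) poi2 v + (1 - \sum_(v <- box K) poi2 v).
  have h1 := esum_box_ge S K poi2_ge0; have h2 := esum_box_le S K poi2_ge0 box_poisson_le1.
  (* Infinite values of the sum are excluded by the two real bounds, so [fine] loses nothing. *)
  rewrite /F; move: h1 h2; case: (esum _ _) => [x| |] //=.
  by rewrite !lee_fin => -> ->.
apply/cvgrPdistC_le => e e0; have e4 : 0 < e / 4 by rewrite divr_gt0.
have [K hK] : exists K, 1 - \sum_(v <- box K) poi2 v <= e / 4.
  have : \forall K \near \oo, `|1 - \sum_(v <- box K) poi2 v| <= e / 4.
    by apply: cvgr_dist_le; [exact: box_poisson_cvg|exact: e4].
  by move=> [K _ hK]; exists K; apply: le_trans (ler_norm _) (hK K _) => /=.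
have hT := @cond_prob_box_cvg (fun=> true) K; have hS := @cond_prob_box_cvg S K.
near=> n.
have := FK K; set q := \sum_(v <- box K | S v) _; set r := \sum_(v <- box K) _ in hK * => /andP[F1 F2].
have h1 : `|cond_prob (p n) (a n) (b n)
   (fun G => ((oA n G, oB n G) \in box K) && S (oA n G, oB n G)) - q| <= e / 4.
  by near: n; apply: cvgr_distC_le; [exact: hS|exact: e4].
have h2 : `|cond_prob (p n) (a n) (b n)
   (fun G => ((oA n G, oB n G) \in box K) && true) - r| <= e / 4.
  by near: n; apply: cvgr_distC_le; [exact: hT|exact: e4].
move: h1 h2; set qn := cond_prob _ _ _ _; set rn := cond_prob _ _ _ _ => h1 h2.
set P := cond_prob _ _ _ _.
have P1 : qn <= P by apply: le_cond_prob => // G _ /andP[].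
have P2 : P <= qn + (1 - rn).
  rewrite -cond_probC//; apply: le_trans (cond_probU _ _ _ _) => //.
  by apply: le_cond_prob => // G _ hS'; rewrite andbT hS' andbT orbN.
move: h1 h2; rewrite !ler_norml => /andP[? ?] /andP[? ?].
by apply/andP; split; lra.
Unshelve. all: by end_near. Qed.

(** Up to constants, the mean number of paths of length k + 1 from a to b; it equals (np)^k p. *)
Let pow_cvg0 k : n%:R ^+ k * p n ^+ k.+1 @[n --> \oo] --> (0 : R).
Proof.
under eq_fun do rewrite exprSr mulrA -exprMn.
rewrite -(mulr0 (lambda ^+ k)); apply: cvgM p_to0.
elim: k => [|k IH]; first by under eq_fun do rewrite expr0; rewrite expr0; exact: cvg_cst.
by under eq_fun do rewrite exprS; rewrite exprS; exact: cvgM.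
Qed.

Lemma whp_paths4 : whp p a b (fun n G => paths4 R G (a n) (b n) == 0).
Proof.
have h2 : 0 < (2^-1 : R) by [].
apply: (whp_sub hab hp _ (whp_markov hab hp (f := fun n G => paths4 R G (a n) (b n)) h2 _ _
  (pow_cvg0 3))).
- apply: nearW => n G _ /=; rewrite /paths4 /ext4.
  under eq_bigr => x _.
    under eq_bigr => y _ do rewrite -natr_sum.
    rewrite -natr_sum -natrM; over.
  rewrite -natr_sum; case: (\sum_(_ | _) _)%N => // m hm.
  have : 1 <= 2^-1 :> R by apply: le_trans hm; rewrite -[leLHS]/(1%:R) ler_nat.
  by move=> ?; exfalso; lra.
- by move=> n G _; exact: paths4_ge0.
- by near=> n; apply: E_paths4 => //; rewrite ler_nat; near: n; exact: nbhs_infty_ge.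
Unshelve. all: by end_near. Qed.

(** Off an event of vanishing probability the curvature equals [Ylimit] of the two degrees, so the
    two distribution functions differ by o(1), and [degrees_cvg] gives the limit of the second. *)
Lemma ricci_regime_b : conv_in_dist p a b kappa (Ylimit_cdf lambda).
Proof.
move=> t _; pose S (v : nat * nat) := Ylimit R v.1 v.2 <= t.
have hS := @degrees_cvg S.
have h1 : whp p a b (fun n G => paths2 R G (a n) (b n) == 0).
  by apply: whp_paths2 => //; have := pow_cvg0 1; under eq_fun do rewrite expr1.
have hg := whp_and hab hp h1 (whp_and hab hp (whp_paths3 hab hp (pow_cvg0 2)) whp_paths4).
have hd : cond_prob (p n) (a n) (b n) (fun G => kappa n G <= t) -
    cond_prob (p n) (a n) (b n) (fun G => S (oA n G, oB n G)) @[n --> \oo] --> (0 : R).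
  apply: cvg0_near => e e0; near=> n.
  have n1 : (2 < n.+2)%N by rewrite !ltnS; near: n; exact: nbhs_infty_gt.
  have hb : cond_prob (p n) (a n) (b n) (fun G => ~~ [&& paths2 R G (a n) (b n) == 0,
     paths3 R G (a n) (b n) == 0 & paths4 R G (a n) (b n) == 0]) <= e.
    by apply: le_trans (ler_norm _) _; near: n; apply: (cvgr0_norm_le _ hg).
  pose good (G : graph n.+2) := [&& paths2 R G (a n) (b n) == 0,
     paths3 R G (a n) (b n) == 0 & paths4 R G (a n) (b n) == 0].
  rewrite -/good in hb.
  have eqS G : adj G (a n) (b n) -> good G -> (kappa n G <= t) = S (oA n G, oB n G).
    by move=> Gab /and3P[/eqP z2 /eqP z3 /eqP z4]; rewrite /S /= (ricci_tree Gab n1).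
  have le1 (A B : pred (graph n.+2)) : (forall G, adj G (a n) (b n) -> good G -> A G = B G) ->
      cond_prob (p n) (a n) (b n) A <= cond_prob (p n) (a n) (b n) B + e.
    move=> AB; apply: (@le_trans _ _ (cond_prob (p n) (a n) (b n) B +
      cond_prob (p n) (a n) (b n) (fun G => ~~ good G))); last by rewrite lerD2l.
    apply: le_trans (cond_probU _ _ _ _) => //; apply: le_cond_prob => // G Gab AG.
    by case: (boolP (good G)) => gG; rewrite ?orbT// -AB// AG.
  have u1 := le1 _ _ eqS; have u2 := le1 _ _ (fun G g1 g2 => esym (eqS G g1 g2)).
  by rewrite ler_norml; apply/andP; split; lra.
have h := cvgD hd hS; rewrite add0r in h.
rewrite (_ : (fun n => _) = fun n =>
  cond_prob (p n) (a n) (b n) (fun G => kappa n G <= t) -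
  cond_prob (p n) (a n) (b n) (fun G => S (oA n G, oB n G)) +
  cond_prob (p n) (a n) (b n) (fun G => S (oA n G, oB n G))); first exact: h.
by apply/funext => n; rewrite subrK.
Unshelve. all: by end_near. Qed.

End PoissonRegime.

(** * Assembly of the six regimes *)

Theorem theorem5p6 (R : realType) (p : nat -> R)
    (a b : forall n, 'I_n.+2)
    (hab : forall n, a n != b n)
    (hp : forall n, 0 < p n <= 1) :
  let kappa := fun n (G : graph n.+2) => ricci (R := R) G (a n) (b n) in
  (* (a) *)
  (((n.+2)%:R * p n @[n --> \oo] --> 0) ->
     (cond_prob (p n) (a n) (b n) (fun G => isolated_edge G (a n) (b n))
        @[n --> \oo] --> (1 : R)) /\
     (forall n (G : graph n.+2), adj G (a n) (b n) ->
        isolated_edge G (a n) (b n) -> kappa n G = 0)) /\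
   (* (b) *)
  (forall lambda : R, 0 < lambda ->
     ((n.+2)%:R * p n @[n --> \oo] --> lambda) ->
     conv_in_dist p a b kappa (Ylimit_cdf lambda)) /\
   (* (c) *)
  (((n.+2)%:R * p n @[n --> \oo] --> +oo) ->
     ((n.+2)%:R ^+ 2 * p n ^+ 3 @[n --> \oo] --> 0) ->
     conv_in_prob p a b kappa (-2)) /\
   (* (d) *)
  (((n.+2)%:R ^+ 2 * p n ^+ 3 @[n --> \oo] --> +oo) ->
     ((n.+2)%:R * p n ^+ 2 @[n --> \oo] --> 0) ->
     conv_in_prob p a b kappa (-1)) /\
   (* (e) *)
  (((n.+2)%:R * p n ^+ 2 @[n --> \oo] --> +oo) ->
     (p n @[n --> \oo] --> 0) ->
     conv_in_prob p a b kappa 0) /\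
   (* (f) *)
  (forall q : R, 0 < q < 1 -> (p n @[n --> \oo] --> q) ->
     conv_in_prob p a b kappa q).
Proof.
move=> kappa.
have p0 n : 0 <= p n by case/andP: (hp n) => /ltW.
have pk0 k n : 0 <= p n ^+ k by rewrite exprn_ge0.
have scale0 (u : nat -> R) : (forall n, 0 <= u n) ->
    n.+2%:R * u n @[n --> \oo] --> (0 : R) -> n%:R * u n @[n --> \oo] --> (0 : R).
  by move=> u0; exact: (@cvg0_scale R 1 u u0).
have scaley (u : nat -> R) : (forall n, 0 <= u n) ->
    n.+2%:R * u n @[n --> \oo] --> +oo -> n%:R * u n @[n --> \oo] --> +oo.
  by move=> u0; exact: (@cvgy_scale R 1 u u0).
split=> [h|].
  split; last by move=> n G; exact: isolated_ricci.
  have hw := whp_isolated hab hp (scale0 _ p0 h).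
  rewrite (_ : (fun n => _) = fun n => 1 - cond_prob (p n) (a n) (b n)
      (fun G => ~~ isolated_edge G (a n) (b n))).
    by rewrite -[X in _ --> X]subr0; apply: cvgB hw; exact: cvg_cst.
  by apply/funext => n; rewrite cond_probC// opprB addrC subrK.
split=> [lambda lambda0 h|].
  have p_to0 : p n @[n --> \oo] --> (0 : R).
    have hN : (n.+2%:R : R)^-1 @[n --> \oo] --> (0 : R).
      have hy : (n.+2%:R : R) @[n --> \oo] --> +oo.
        apply/cvgryPge => A; near=> n; apply: (@le_trans _ _ n%:R); last by rewrite ler_nat; lia.
        by near: n; move/cvgryPge : (@cvgn_natr R); exact.
      by have := cvgy_div0 ler01 hy; under eq_fun do rewrite div1r.
    rewrite (_ : p = fun n => n.+2%:R * p n * (n.+2%:R)^-1).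
      by rewrite -(mulr0 lambda); exact: cvgM.
    by apply/funext => n; rewrite mulrAC mulfV ?mul1r// pnatr_eq0.
  apply: ricci_regime_b => //.
  (* The correction 2p to the limit of (n + 2)p vanishes since p tends to 0. *)
  rewrite (_ : (fun n => _) = fun n => n.+2%:R * p n - 2 * p n).
    rewrite -[lambda]subr0 -(mulr0 2); apply: cvgB h _.
    by apply: cvgM p_to0; exact: cvg_cst.
  by apply/funext => n; rewrite -mulrBl -natrB// subn2.
split=> [h1 h3|].
  by apply: ricci_regime_c => //; [exact: scaley|exact: cvg0_scale].
split=> [h3 h2|].
  by apply: ricci_regime_d => //; [exact: cvgy_scale|exact: scale0].
split=> [h2 hq|q /andP[q0 q1] hq].
  by apply: ricci_regime_ef => //; [rewrite lexx ltr01|exact: scaley].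
apply: ricci_regime_ef => //; first by rewrite (ltW q0).
(* Divergence of n p^2 follows from p >= q/2 eventually. *)
have q2 : q / 2 < q by lra.
apply/cvgryPge => A; near=> n.
have pq : q / 2 <= p n.
  by apply: ltW; near: n; exact: cvgr_gt hq _ q2.
have q20 : 0 < q / 2 by rewrite divr_gt0.
apply: (@le_trans _ _ (n%:R * (q / 2) ^+ 2)).
  rewrite -ler_pdivrMr ?exprn_gt0//.
  by near: n; move/cvgryPge : (@cvgn_natr R); exact.
by apply: ler_wpM2l => //; apply: lerXn2r => //; rewrite nnegrE// ltW.
Unshelve. all: by end_near. Qed.
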